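(* Let $k$ be a field, and let $\Gamma$ be a finite-type connected graded $k$-coalgebra which is not bounded below and whose dual algebra $\Gamma^*$ is a $\mathcal{P}$-algebra. Write $I_j$ for the homogeneous left ideal of $\Gamma^*$ generated by all homogeneous elements of degree $\geq j$. Suppose that for every graded $\Gamma^*$-module $M$ and every integer $n$ there is an isomorphism of abelian groups $$H^n_{dist}(M)\;\cong\;\mathrm{colim}_{j\to\infty}\mathrm{Ext}^n_{\mathrm{gr\,Mod}(\Gamma^* )}(\Gamma^*/I_j,M),$$ natural in $M$. Then there are no nonzero projective objects in the category of graded $\Gamma$-comodules.
   Context: ''Graded'' means $\mathbb{Z}$-graded; ''finite-type'' means finite-dimensional in each degree; ''bounded below'' means zero in all sufficiently negative degrees. A graded $k$-algebra is connected if it is concentrated in nonnegative degrees with one-dimensional degree $0$ summand; a graded $k$-coalgebra is connected if it is concentrated in nonpositive degrees with one-dimensional degree $0$ summand. Comodules are left comodules. $\Gamma^*$ is the graded $k$-linear dual algebra of $\Gamma$, with functionals on the degree $n$ summand placed in degree $-n$. $\mathrm{Ext}$ and $\hom$ of graded modules are graded: the degree $d$ part of $\hom(M,N)$ is the group of grading-preserving maps $\Sigma^dM\to N$, where $\Sigma M$ is $M$ with all degrees increased by $1$. The functor $\iota:\mathrm{gr\,Comod}(\Gamma)\to\mathrm{gr\,Mod}(\Gamma^* )$ sends a graded comodule $M$ with coaction $\psi_M$ to the same graded vector space with action $f\cdot m=(f\otimes\mathrm{id}_M)(\psi_M(m))$ (the multiplication on $\Gamma^*$ is dual to the coproduct,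 ordered so that this is a left action). Distinguished local cohomology. A homogeneous left ideal $I$ of $\Gamma^*$ is strongly distinguished if $\iota(\Gamma)$ contains a graded $\Gamma^*$-submodule isomorphic to a suspension of $\Gamma^*/I$. A homogeneous left ideal is distinguished if it contains an intersection of a finite set of strongly distinguished ideals. For a graded $\Gamma^*$-module $M$, $h^0_{dist}(M)$ is the graded subgroup of $M$ consisting of the elements annihilated by some distinguished left ideal (i.e. $\mathrm{colim}_I\hom(\Gamma^*/I,M)$ over distinguished $I$), and $H^0_{dist}(M)$ is the graded $\Gamma^*$-submodule of $M$ generated by $h^0_{dist}(M)$. $H^n_{dist}$ is the $n$th right derived functor of $H^0_{dist}:\mathrm{gr\,Mod}(\Gamma^* )\to\mathrm{gr\,Mod}(\Gamma^* )$. Poincaré algebra: a finite-dimensional connected graded $k$-algebra $B$ with a map of graded $k$-vector spaces $e:B\to\Sigma^nk$, for some $n$, such that for all $q$ the pairing $B^q\otimes_kB^{n-q}\to B^n\xrightarrow{e}k$ is nondegenerate. $\mathcal{P}$-algebra: a connected graded $k$-algebra $A$ which is the union of an increasing chain of subalgebras $A(0)\subsetneq A(1)\subsetneq\cdots$ with each $A(n)$ a Poincaré algebra and each $A(n+1)$ flat as a right $A(n)$-module. *)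

(* Defs.v *)
From HB Require Import structures.
From mathcomp Require Import all_boot all_order all_algebra generic_quotient ring_quotient.
From mathcomp Require Import boolp classical_sets functions.
From mathcomp.multinomials Require Import freeg.

Set Implicit Arguments.
Unset Strict Implicit.
Unset Printing Implicit Defensive.

Import GRing.Theory.
Local Open Scope ring_scope.
Local Open Scope quotient_scope.

Section Submodules.
Variables (R : pzRingType) (V : lmodType R).

Lemma submodN (S : submodClosed V) : oppr_closed S.
Proof. by move=> x Sx; rewrite -scaleN1r rpredZ. Qed.

Definition gen_submod (X : set V) : {pred V} :=
  fun x => `[< forall S : submodClosed V, (forall y, X y -> y \in S) -> x \in S >].

Lemma gen_submod_closed X : submod_closed (gen_submod X).
Proof.
split=> [|a u v /asboolP Su /asboolP Sv]; apply/asboolP => S XS.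
  exact: rpred0.
by rewrite rpredD ?rpredZ ?Su ?Sv.
Qed.

HB.instance Definition _ X := GRing.isSubmodClosed.Build R V (gen_submod X)
  (gen_submod_closed X).

Lemma mem_gen_submod (X : set V) x : X x -> x \in gen_submod X.
Proof. by move=> Xx; apply/asboolP => S; apply. Qed.

Lemma gen_submod_min (X : set V) (S : submodClosed V) :
  (forall y, X y -> y \in S) -> {subset gen_submod X <= S}.
Proof. by move=> XS x /asboolP; apply. Qed.

Record submod_of (S : submodClosed V) :=
  Submod { submod_val : V; submod_valP : submod_val \in S }.
HB.instance Definition _ (S : submodClosed V) := [isSub for @submod_val S].
HB.instance Definition _ (S : submodClosed V) := [Choice of submod_of S by <:].

Definition submod_zclosed (S : submodClosed V) : {pred V} := fun x => x \in S.
Lemma submod_zclosedP S : zmod_closed (submod_zclosed S).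
Proof. by split=> [|x y]; rewrite -!topredE /= /submod_zclosed ?rpred0 // => Sx Sy; rewrite rpredD // submodN. Qed.
HB.instance Definition _ S := GRing.isZmodClosed.Build V (submod_zclosed S)
  (submod_zclosedP S).

HB.instance Definition _ (S : submodClosed V) :=
  GRing.SubChoice_isSubLmodule.Build R V (fun x => x \in S) (submod_of S)
    (GRing.subsemimodClosedP S).

Definition quot_mod (S : submodClosed V) : Type := Quotient.quot (submod_zclosed S).
HB.instance Definition _ S := GRing.Zmodule.on (quot_mod S).

Section Quotient.
Variable S : submodClosed V.
Let Q := Quotient.quot (submod_zclosed S).

Definition quot_pi (x : V) : quot_mod S := \pi_Q x.
Definition quot_repr (q : quot_mod S) : V :=
  repr (q : Q).

Lemma quot_reprK q : quot_pi (quot_repr q) = q.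
Proof. exact: reprK. Qed.

Lemma quot_piP x y : quot_pi x = quot_pi y <-> x - y \in S.
Proof.
have := Quotient.idealrBE (submod_zclosed S) x y; rewrite -topredE /= => e.
by split=> [xy|Sxy]; [rewrite e; apply/eqP | apply/eqP; rewrite -e].
Qed.

Lemma quot_pi_repr x : quot_repr (quot_pi x) - x \in S.
Proof. by apply/quot_piP; rewrite quot_reprK. Qed.

Fact quot_pi_is_additive : zmod_morphism quot_pi.
Proof. exact: (raddfB (\pi_Q)). Qed.

HB.instance Definition _ := GRing.isZmodMorphism.Build V (quot_mod S) quot_pi
  quot_pi_is_additive.

Definition quot_scale (c : R) (q : quot_mod S) := quot_pi (c *: quot_repr q).

Lemma quot_scaleE c x : quot_scale c (quot_pi x) = quot_pi (c *: x).
Proof. by apply/quot_piP; rewrite -scalerBr rpredZ // quot_pi_repr. Qed.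

Fact quot_scaleA a b q : quot_scale a (quot_scale b q) = quot_scale (a * b) q.
Proof. by rewrite -[q]quot_reprK !quot_scaleE scalerA. Qed.
Fact quot_scale1 : left_id 1 quot_scale.
Proof. by move=> q; rewrite -[q]quot_reprK !quot_scaleE scale1r. Qed.
Fact quot_scaleDr : right_distributive quot_scale +%R.
Proof.
move=> c p q; rewrite -[p]quot_reprK -[q]quot_reprK -raddfD !quot_scaleE.
by rewrite scalerDr raddfD.
Qed.
Fact quot_scaleDl q : {morph quot_scale^~ q : a b / a + b}.
Proof.
by move=> a b; rewrite -[q]quot_reprK !quot_scaleE scalerDl raddfD.
Qed.
HB.instance Definition _ := GRing.Zmodule_isLmodule.Build R (quot_mod S)
  quot_scaleA quot_scale1 quot_scaleDr quot_scaleDl.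

Fact quot_pi_is_scalable : scalable quot_pi.
Proof. by move=> c x; apply/esym/quot_scaleE. Qed.
HB.instance Definition _ := GRing.isScalable.Build R V (quot_mod S) *:%R
  quot_pi quot_pi_is_scalable.
End Quotient.
End Submodules.

Section Presented.
Variables (R : nzRingType) (X : choiceType) (rel : set {freeg X / R}).

(* The R-module with generators [X] and relations [rel]. *)
Definition presented : Type := quot_mod (gen_submod rel).
HB.instance Definition _ := GRing.Lmodule.on presented.

Definition pgen (x : X) : presented := quot_pi _ << x >>.

Lemma pgen_rel r : rel r -> quot_pi (gen_submod rel) r = 0.
Proof.
by move=> rr; rewrite -(raddf0 (quot_pi _)); apply/quot_piP; rewrite subr0 mem_gen_submod.
Qed.

Lemma presented_ind (P : presented -> Prop) :
  P 0 -> (forall x, P (pgen x)) -> (forall t u, P t -> P u -> P (t + u)) ->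
  (forall c t, P t -> P (c *: t)) -> forall t, P t.
Proof.
move=> P0 Pgen Padd Pscale t; rewrite -[t]quot_reprK.
rewrite -[quot_repr t]freeg_sumE raddf_sum /=.
apply: (big_ind P) => // x _.
suff -> : << coeff x (quot_repr t) *g x >> = coeff x (quot_repr t) *: << x >>.
  by rewrite linearZ; apply/Pscale/Pgen.
by apply/eqP/freeg_eqP => y; rewrite coeffZ !coeffU mul1r.
Qed.

(* The linear map out of [presented] sending [pgen x] to [f x].  It is computed
   on representatives, hence only meaningful if [f] respects the relations. *)
Definition plift (U : lmodType R) (f : X -> U) (t : presented) : U :=
  fglift f (quot_repr t).

Section Lift.
Variables (U : lmodType R) (f : X -> U).

Fact fglift_additive : zmod_morphism (fglift f : {freeg X / R} -> U).
Proof. exact: lift_is_additive. Qed.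
HB.instance Definition _ := GRing.isZmodMorphism.Build {freeg X / R} U (fglift f)
  fglift_additive.

Lemma fgliftE r : fglift f r = \sum_(x <- dom r) coeff x r *: f x.
Proof.
rewrite -{1}[r]freeg_sumE raddf_sum /=; apply: eq_bigr => x _; exact: liftU.
Qed.

Fact fglift_scalable : scalable (fglift f : {freeg X / R} -> U).
Proof.
move=> c r; rewrite [c *: r]/GRing.scale /= /fgscale raddf_sum /= fgliftE.
by rewrite scaler_sumr; apply: eq_bigr => x _; rewrite liftU scalerA.
Qed.
HB.instance Definition _ := GRing.isScalable.Build R {freeg X / R} U *:%R
  (fglift f) fglift_scalable.

Definition fglift_ker : {pred {freeg X / R}} := fun r => fglift f r == 0.
Lemma fglift_ker_closed : submod_closed fglift_ker.
Proof.
split=> [|c u v]; rewrite -!topredE /= /fglift_ker ?raddf0 // => /eqP u0 /eqP v0.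
by rewrite raddfD /= linearZ /= u0 v0 scaler0 addr0.
Qed.
HB.instance Definition _ := GRing.isSubmodClosed.Build R {freeg X / R} fglift_ker
  fglift_ker_closed.

Hypothesis f_rel : forall r, rel r -> fglift f r = 0.

Lemma plift_pi r : plift f (quot_pi _ r) = fglift f r.
Proof.
apply/eqP; rewrite -subr_eq0 -raddfB /=.
have : {subset gen_submod rel <= fglift_ker}.
  by apply: gen_submod_min => y /f_rel y0; rewrite -topredE /= /fglift_ker y0.
by move=> /(_ _ (quot_pi_repr _ r)); rewrite -topredE.
Qed.

Lemma plift_gen x : plift f (pgen x) = f x.
Proof. by rewrite plift_pi liftU scale1r. Qed.

Lemma plift_linear : linear (plift f).
Proof.
move=> c t u; rewrite -[t]quot_reprK -[u]quot_reprK -linearZ -raddfD.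
by rewrite !plift_pi raddfD /= linearZ.
Qed.
End Lift.
End Presented.


Section Tensor.
Variables (k : fieldType) (V W : lmodType k).

Inductive tensor_rel : set {freeg (V * W) / k} :=
| TensorDl v v' w : tensor_rel (<< (v + v', w) >> - << (v, w) >> - << (v', w) >>)
| TensorDr v w w' : tensor_rel (<< (v, w + w') >> - << (v, w) >> - << (v, w') >>)
| TensorZl c v w : tensor_rel (<< (c *: v, w) >> - c *: << (v, w) >>)
| TensorZr c v w : tensor_rel (<< (v, c *: w) >> - c *: << (v, w) >>).

Definition tensor : Type := presented tensor_rel.
HB.instance Definition _ := GRing.Lmodule.on tensor.

Definition tens (v : V) (w : W) : tensor := pgen tensor_rel (v, w).

Definition bilin (U : lmodType k) (f : V -> W -> U) : Prop :=
  (forall w, linear (f^~ w)) /\ (forall v, linear (f v)).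

(* The linear map induced by a bilinear [f]. *)
Definition tlift (U : lmodType k) (f : V -> W -> U) (t : tensor) : U :=
  plift (fun p => f p.1 p.2) t.

Lemma tens_bilin : bilin tens.
Proof.
split=> [w c v v'|v c w w'].
- transitivity (tens (c *: v) w + tens v' w).
    apply/eqP; rewrite -subr_eq0 opprD addrA -!raddfB /=.
    by apply/eqP/pgen_rel/TensorDl.
  congr (_ + _); apply/eqP; rewrite -subr_eq0 -[c *: tens _ _]linearZ -!raddfB /=.
  by apply/eqP/pgen_rel/TensorZl.
- transitivity (tens v (c *: w) + tens v w').
    apply/eqP; rewrite -subr_eq0 opprD addrA -!raddfB /=.
    by apply/eqP/pgen_rel/TensorDr.
  congr (_ + _); apply/eqP; rewrite -subr_eq0 -[c *: tens _ _]linearZ -!raddfB /=.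
  by apply/eqP/pgen_rel/TensorZr.
Qed.


Section Bilin.
Variables (U : lmodType k) (f : V -> W -> U).
Hypothesis fB : bilin f.
Lemma bilinDl v v' w : f (v + v') w = f v w + f v' w.
Proof. by have := fB.1 w 1 v v'; rewrite !scale1r. Qed.
Lemma bilinDr v w w' : f v (w + w') = f v w + f v w'.
Proof. by have := fB.2 v 1 w w'; rewrite !scale1r. Qed.
Lemma bilin0l w : f 0 w = 0.
Proof. by apply: (addIr (f 0 w)); rewrite -bilinDl !add0r. Qed.
Lemma bilin0r v : f v 0 = 0.
Proof. by apply: (addIr (f v 0)); rewrite -bilinDr !add0r. Qed.
Lemma bilinZl c v w : f (c *: v) w = c *: f v w.
Proof. by have := fB.1 w c v 0; rewrite bilin0l !addr0. Qed.
Lemma bilinZr c v w : f v (c *: w) = c *: f v w.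
Proof. by have := fB.2 v c w 0; rewrite bilin0r !addr0. Qed.

Lemma bilin_rel r : tensor_rel r -> fglift (fun p => f p.1 p.2) r = 0.
Proof.
case=> [v v' w|v w w'|c v w|c v w]; rewrite !raddfB /= ?fglift_scalable !liftU !scale1r /=.
- by rewrite bilinDl -addrA -opprD subrr.
- by rewrite bilinDr -addrA -opprD subrr.
- by rewrite bilinZl subrr.
- by rewrite bilinZr subrr.
Qed.

Lemma tlift_tens v w : tlift f (tens v w) = f v w.
Proof. exact: (plift_gen bilin_rel). Qed.

Lemma tlift_linear : linear (tlift f).
Proof. exact: (plift_linear bilin_rel). Qed.
End Bilin.

Lemma tensor_ind (P : tensor -> Prop) :
  P 0 -> (forall v w, P (tens v w)) -> (forall t u, P t -> P u -> P (t + u)) ->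
  forall t, P t.
Proof.
move=> P0 Pg PD.
suff H t : forall c, P (c *: t) by move=> t; rewrite -[t]scale1r.
apply: (presented_ind (P := fun t => forall c, P (c *: t))) => {t}.
- by move=> c; rewrite scaler0.
- by move=> [v w] c; rewrite -[pgen _ _]/(tens v w) -(bilinZl tens_bilin).
- by move=> t u Pt Pu c; rewrite scalerDr; apply: (PD (c *: t) (c *: u)).
- by move=> c t Pt d; have := Pt (d * c); rewrite -scalerA.
Qed.

Lemma tensor_ext (U : lmodType k) (f g : tensor -> U) : linear f -> linear g ->
  (forall v w, f (tens v w) = g (tens v w)) -> f =1 g.
Proof.
move=> fL gL fg.
have lin0 h : linear h -> h (0 : tensor) = (0 : U).
  by move=> hL; apply: (addIr (h 0)); have := hL 1 0 0; rewrite !scale1r !add0r.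
have linD h : linear h -> forall t u : tensor, h (t + u) = h t + h u :> U.
  by move=> hL t u; have := hL 1 t u; rewrite !scale1r.
by apply: tensor_ind => [|//|t u IHt IHu]; rewrite ?lin0 // !linD // IHt IHu.
Qed.
End Tensor.

Section ModuleTensor.
Variable R : pzRingType.

(* Right R-modules are left modules over the converse ring [R^c]; here is the
   right multiplication. *)
Definition rmul (M : lmodType R^c) (x : M) (r : R) : M := (r : R^c) *: x.

Inductive mtensor_rel (M : lmodType R^c) (N : lmodType R) :
  set {freeg (M * N) / int} :=
| MTensorDl x x' y :
    mtensor_rel (<< (x + x', y) >> - << (x, y) >> - << (x', y) >>)
| MTensorDr x y y' :
    mtensor_rel (<< (x, y + y') >> - << (x, y) >> - << (x, y') >>)
| MTensorM x r y : mtensor_rel (<< (rmul x r, y) >> - << (x, r *: y) >>).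

Definition mtensor (M : lmodType R^c) (N : lmodType R) : Type :=
  presented (@mtensor_rel M N).
HB.instance Definition _ M N := GRing.Lmodule.on (mtensor M N).

Definition mtens (M : lmodType R^c) (N : lmodType R) (x : M) (y : N) :
  mtensor M N := pgen (@mtensor_rel M N) (x, y).

Definition mtensor_map (M : lmodType R^c) (N N' : lmodType R)
    (f : {linear N -> N'}) : mtensor M N -> mtensor M N' :=
  plift (fun p => mtens p.1 (f p.2)).

Lemma mtensor_mapE (M : lmodType R^c) (N N' : lmodType R) (f : {linear N -> N'})
    (x : M) (y : N) : mtensor_map f (mtens x y) = mtens x (f y).
Proof.
apply: plift_gen => r; case=> [u u' v|u v v'|u a v].
- rewrite !raddfB /= !liftU !scale1r /= -!raddfB; exact/pgen_rel/MTensorDl.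
- rewrite !raddfB /= !liftU !scale1r /= raddfD -!raddfB; exact/pgen_rel/MTensorDr.
- rewrite !raddfB /= !liftU !scale1r /= linearZ -!raddfB; exact/pgen_rel/MTensorM.
Qed.

Definition flat (M : lmodType R^c) : Prop :=
  forall (N N' : lmodType R) (f : {linear N -> N'}),
    injective f -> injective (mtensor_map (M := M) f).
End ModuleTensor.

Section Colimit.
Variables (G : nat -> zmodType) (t : forall j, G j -> G j.+1).

Definition stage (j : nat) (x : G j) : {freeg {j : nat & G j} / int} :=
  << existT G j x >>.

Inductive colim_rel : set {freeg {j : nat & G j} / int} :=
| ColimD j (x y : G j) : colim_rel (stage (x + y) - stage x - stage y)
| ColimT j (x : G j) : colim_rel (stage x - stage (t x)).

Definition colim : Type := presented colim_rel.
HB.instance Definition _ := GRing.Lmodule.on colim.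
Definition colim_in (j : nat) (x : G j) : colim :=
  pgen colim_rel (existT G j x).
End Colimit.

Definition colim_map (G G' : nat -> zmodType) t t' (f : forall j, G j -> G' j) :
    @colim G t -> @colim G' t' :=
  plift (fun p => colim_in t' (f (tag p) (tagged p))).

Lemma colim_mapE (G G' : nat -> zmodType) (t : forall j, G j -> G j.+1)
    (t' : forall j, G' j -> G' j.+1) (f : forall j, G j -> G' j) :
  (forall j, zmod_morphism (f j)) -> (forall j x, t' j (f j x) = f j.+1 (t j x)) ->
  forall j (x : G j), colim_map t' f (colim_in t x) = colim_in t' (f j x).
Proof.
move=> fB ft j x; apply: plift_gen => r; case=> [i u v|i u].
- rewrite !raddfB /= !liftU !scale1r /=.
  have -> : f i (u + v) = f i u + f i v.
    have f0 : f i 0 = 0 by rewrite -(subrr 0) fB subrr.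
    by rewrite -[v in LHS]opprK fB -[- v]sub0r fB f0 sub0r opprK.
  rewrite -!raddfB; exact/pgen_rel/ColimD.
- rewrite !raddfB /= !liftU !scale1r /= -ft -raddfB; exact/pgen_rel/ColimT.
Qed.

Section Cohomology.
Variables (Cm C Cp : zmodType) (d0 : {additive Cm -> C}) (d1 : {additive C -> Cp}).

Definition cocycle : {pred C} := fun x => d1 x == 0.
Lemma cocycle_zmod_closed : zmod_closed cocycle.
Proof.
split=> [|x y]; rewrite -!topredE /= /cocycle ?raddf0 // => /eqP x0 /eqP y0.
by rewrite raddfB /= x0 y0 subr0.
Qed.
HB.instance Definition _ := GRing.isZmodClosed.Build C cocycle cocycle_zmod_closed.

Record cocycles := Cocycle { cocycle_val : C; _ : cocycle_val \in cocycle }.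
HB.instance Definition _ := [isSub for cocycle_val].
HB.instance Definition _ := [Choice of cocycles by <:].
HB.instance Definition _ := [SubChoice_isSubZmodule of cocycles by <:].

Definition coboundary : {pred cocycles} :=
  fun z => `[< exists y, d0 y = val z >].
Lemma coboundary_zmod_closed : zmod_closed coboundary.
Proof.
split=> [|x y /asboolP[x' xE] /asboolP[y' yE]]; apply/asboolP.
  by exists 0; rewrite !raddf0.
by exists (x' - y'); rewrite !raddfB /= xE yE.
Qed.
HB.instance Definition _ := GRing.isZmodClosed.Build cocycles coboundary
  coboundary_zmod_closed.

Definition cohomology : Type := Quotient.quot coboundary.
HB.instance Definition _ := GRing.Zmodule.on cohomology.
Definition cohom_class (z : cocycles) : cohomology := \pi_(Quotient.quot coboundary) z.
Definition cohom_repr (h : cohomology) : cocycles := repr (h : Quotient.quot coboundary).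
End Cohomology.

(* The map induced on cohomology by the middle component of a map of complexes;
   [insubd] uses its default value only if [f] does not preserve cocycles. *)
Definition cohom_map (Cm C Cp : zmodType) (d0 : {additive Cm -> C})
    (d1 : {additive C -> Cp}) (Dm D Dp : zmodType) (e0 : {additive Dm -> D})
    (e1 : {additive D -> Dp}) (f : C -> D) (h : cohomology d0 d1) :
    cohomology e0 e1 :=
  cohom_class e0 (insubd 0 (f (val (cohom_repr h)))).

Lemma cohom_mapE (Cm C Cp Dm D Dp : zmodType) (d0 : {additive Cm -> C})
    (d1 : {additive C -> Cp}) (e0 : {additive Dm -> D}) (e1 : {additive D -> Dp})
    (fm : Cm -> Dm) (f : {additive C -> D}) (fp : {additive Cp -> Dp}) :
  (forall x, e0 (fm x) = f (d0 x)) -> (forall x, e1 (f x) = fp (d1 x)) ->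
  forall (z : cocycles d1) (fz : f (val z) \in cocycle e1),
    cohom_map e0 e1 f (cohom_class d0 z) = cohom_class e0 (Cocycle fz).
Proof.
move=> f0 f1 z fz; rewrite /cohom_map.
have fC (w : cocycles d1) : f (val w) \in cocycle e1.
  have := valP w; rewrite -!topredE /= /cocycle f1 => /eqP ->.
  by rewrite raddf0.
apply/eqP; rewrite -[_ == _]/(_ == _ %[mod Quotient.quot (@coboundary _ _ _ e0 e1)]).
rewrite -Quotient.idealrBE; set w := cohom_repr _.
have /asboolP[y yE] : w - z \in @coboundary _ _ _ d0 d1.
  by rewrite Quotient.idealrBE; apply/eqP; exact: reprK.
apply/asboolP; exists (fm y); rewrite f0 yE !raddfB /=.
by rewrite val_insubd fC.
Qed.


(* A Z-grading V = \bigoplus_i V_i is recorded by the projections [comp i] of V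
   onto the summands; V_i is the set [homog G i] of fixed points of [comp i]. *)
Record grading (V : zmodType) := Grading {
  comp : int -> {additive V -> V};
  comp_comp : forall i j x, comp i (comp j x) = if i == j then comp j x else 0;
  comp_sum : forall x, exists2 s : seq int, uniq s & x = \sum_(i <- s) comp i x }.

Definition homog (V : zmodType) (G : grading V) (i : int) : set V :=
  fun x => comp G i x = x.

Lemma homog_comp (V : zmodType) (G : grading V) i x : homog G i (comp G i x).
Proof. by rewrite /homog comp_comp eqxx. Qed.

Lemma comp_homog (V : zmodType) (G : grading V) i j x : homog G j x ->
  comp G i x = if i == j then x else 0.
Proof. by move=> xj; rewrite -xj comp_comp. Qed.

Definition bounded_below (V : zmodType) (G : grading V) : Prop :=
  exists N : int, forall (i : int) x, i < N -> homog G i x -> x = 0.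

Definition fin_dim (k : fieldType) (V : lmodType k) (P : set V) : Prop :=
  exists n (b : 'I_n -> V), forall x, P x ->
    exists c : 'I_n -> k, x = \sum_i c i *: b i.

Definition one_dim (k : fieldType) (V : lmodType k) (P : set V) : Prop :=
  exists e : V, [/\ P e, e != 0 & forall x, P x -> exists c : k, x = c *: e].

Record gvect (k : fieldType) := GVect {
  gv_car :> lmodType k;
  gv_gr : grading gv_car;
  gv_scale : forall i c x, comp gv_gr i (c *: x) = c *: comp gv_gr i x }.

Record galg (k : fieldType) := GAlg {
  ga_car :> algType k;
  ga_gr : grading ga_car;
  ga_scale : forall i c x, comp ga_gr i (c *: x) = c *: comp ga_gr i x;
  ga_one : homog ga_gr 0 1;
  ga_mul : forall i j x y, homog ga_gr i x -> homog ga_gr j y ->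
    homog ga_gr (i + j) (x * y) }.

Definition connected_alg (k : fieldType) (A : galg k) : Prop :=
  (forall (i : int) x, i < 0 -> homog (ga_gr A) i x -> x = 0) /\
  one_dim (homog (ga_gr A) 0).


Definition poincare (k : fieldType) (B : galg k) : Prop :=
  [/\ fin_dim [set: B], connected_alg B
    & exists (n : int) (e : {scalar B}),
      (forall i x, i != n -> homog (ga_gr B) i x -> e x = 0) /\
      (forall q,
        (forall x, homog (ga_gr B) q x ->
          (forall y, homog (ga_gr B) (n - q) y -> e (x * y) = 0) -> x = 0) /\
        (forall y, homog (ga_gr B) (n - q) y ->
          (forall x, homog (ga_gr B) q x -> e (x * y) = 0) -> y = 0))].

Section Subalgebra.
Variables (k : fieldType) (A : galg k).

Record subalg (S : subalgClosed A) :=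
  Subalg { subalg_val : A; subalg_valP : subalg_val \in S }.
HB.instance Definition _ (S : subalgClosed A) := [isSub for @subalg_val S].
HB.instance Definition _ (S : subalgClosed A) := [Choice of subalg S by <:].
HB.instance Definition _ (S : subalgClosed A) :=
  GRing.SubChoice_isSubAlgebra.Build k A (fun x => x \in S) (subalg S)
    (GRing.subsemialgClosedP S).

Section Graded.
Variable S : subalgClosed A.
Hypothesis hS : forall i x, x \in S -> comp (ga_gr A) i x \in S.

Definition subalg_comp i (x : subalg S) : subalg S :=
  Subalg (hS i (subalg_valP x)).
Fact subalg_comp_additive i : zmod_morphism (subalg_comp i).
Proof. by move=> x y; apply: val_inj; rewrite /= raddfB. Qed.
HB.instance Definition _ i := GRing.isZmodMorphism.Build (subalg S) (subalg S)
  (subalg_comp i) (subalg_comp_additive i).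

Fact subalg_comp_comp i j x :
  subalg_comp i (subalg_comp j x) = if i == j then subalg_comp j x else 0.
Proof. by apply: val_inj; rewrite /= comp_comp; case: eqP. Qed.
Fact subalg_comp_sum x :
  exists2 s : seq int, uniq s & x = \sum_(i <- s) subalg_comp i x.
Proof.
have [s us xE] := comp_sum (ga_gr A) (val x); exists s => //.
by apply: val_inj; rewrite raddf_sum /= -xE.
Qed.
Definition subalg_grading : grading (subalg S) :=
  @Grading (subalg S) subalg_comp subalg_comp_comp subalg_comp_sum.

Fact subalg_homog i x : homog subalg_grading i x <-> homog (ga_gr A) i (val x).
Proof. by split=> [/(congr1 val)|h] //; apply: val_inj. Qed.

Fact subalg_scale i c x :
  comp subalg_grading i (c *: x) = c *: comp subalg_grading i x.
Proof. by apply: val_inj; rewrite /= ga_scale. Qed.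
Fact subalg_one : homog subalg_grading 0 1.
Proof. by apply/subalg_homog/ga_one. Qed.
Fact subalg_mul i j x y : homog subalg_grading i x -> homog subalg_grading j y ->
  homog subalg_grading (i + j) (x * y).
Proof. by move=> /subalg_homog xi /subalg_homog yj; apply/subalg_homog/ga_mul. Qed.
Definition sub_galg : galg k :=
  @GAlg k (subalg S) subalg_grading subalg_scale subalg_one subalg_mul.
End Graded.

Section Inclusion.
Variables (S T : subalgClosed A) (hST : {subset S <= T}).
Definition subalg_incl (x : subalg S) : subalg T := Subalg (hST (subalg_valP x)).
Fact subalg_incl_additive : zmod_morphism subalg_incl.
Proof. by move=> x y; apply: val_inj. Qed.
Fact subalg_incl_monoid : monoid_morphism subalg_incl.
Proof. by split=> [|x y]; apply: val_inj. Qed.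
HB.instance Definition _ := GRing.isZmodMorphism.Build (subalg S) (subalg T)
  subalg_incl subalg_incl_additive.
HB.instance Definition _ := GRing.isMonoidMorphism.Build (subalg S) (subalg T)
  subalg_incl subalg_incl_monoid.
End Inclusion.
End Subalgebra.

(* [B] as a right [R]-module through a ring morphism [R -> B]. *)
Section RightModule.
Variables (R B : pzRingType) (f : {rmorphism R -> B}).
Definition right_mod of {rmorphism R -> B} : Type := B.
Local Notation M := (right_mod f).
HB.instance Definition _ := GRing.Zmodule.on M.
Definition right_scale (r : R^c) (x : M) : M := (x : B) * f r.
Fact right_scaleA a b x : right_scale a (right_scale b x) = right_scale (a * b) x.
Proof. by rewrite /right_scale -mulrA -rmorphM. Qed.
Fact right_scale1 : left_id 1 right_scale.
Proof. by move=> x; rewrite /right_scale rmorph1 mulr1. Qed.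
Fact right_scaleDr : right_distributive right_scale +%R.
Proof. by move=> a x y; rewrite /right_scale mulrDl. Qed.
Fact right_scaleDl x : {morph right_scale^~ x : a b / a + b}.
Proof. by move=> a b; rewrite /right_scale rmorphD mulrDr. Qed.
HB.instance Definition _ := GRing.Zmodule_isLmodule.Build R^c M
  right_scaleA right_scale1 right_scaleDr right_scaleDl.
End RightModule.

Definition P_algebra (k : fieldType) (A : galg k) : Prop :=
  connected_alg A /\
  exists (S : nat -> subalgClosed A)
         (hom : forall n i x, x \in S n -> comp (ga_gr A) i x \in S n)
         (inc : forall n, {subset S n <= S n.+1}),
    [/\ forall n, exists2 x, x \in S n.+1 & x \notin S n,
        forall x, exists n, x \in S n,
        forall n, poincare (sub_galg (hom n))
      & forall n, flat (right_mod (subalg_incl (inc n)))].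


Record grmod (k : fieldType) (A : galg k) := GrMod {
  gm_car :> lmodType A;
  gm_gr : grading gm_car;
  gm_act : forall i j a x, homog (ga_gr A) i a -> homog gm_gr j x ->
    homog gm_gr (i + j) (a *: x) }.

Section GrMod.
Variables (k : fieldType) (A : galg k).
Implicit Types M N X Y Z : grmod A.

Record grhom M N := GrHom {
  gh_fun :> {linear M -> N};
  gh_comp : forall i x, gh_fun (comp (gm_gr M) i x) = comp (gm_gr N) i (gh_fun x) }.

Definition grmono X Y (f : grhom X Y) : Prop :=
  forall Z (u v : grhom Z X), (forall z, f (u z) = f (v z)) -> u =1 v.

Definition grinjective J : Prop :=
  forall X Y (i : grhom X Y), grmono i -> forall f : grhom X J,
    exists g : grhom Y J, forall x, g (i x) = f x.

Lemma comp_act M n a (s : seq int) x : uniq s -> a = \sum_(i <- s) comp (ga_gr A) i a ->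
  comp (gm_gr M) n (a *: x) =
  \sum_(i <- s) comp (ga_gr A) i a *: comp (gm_gr M) (n - i) x.
Proof.
move=> us aE; rewrite {1}aE scaler_suml raddf_sum /=; apply: eq_bigr => i _.
have [r ur xE] := comp_sum (gm_gr M) x.
have H j : comp (gm_gr M) n (comp (ga_gr A) i a *: comp (gm_gr M) j x) =
    if n == i + j then comp (ga_gr A) i a *: comp (gm_gr M) j x else 0.
  by rewrite (@comp_homog _ _ n (i + j)) //; apply: gm_act; apply: homog_comp.
rewrite {1}xE [in RHS]xE !scaler_sumr !raddf_sum /= ?scaler_sumr.
apply: eq_bigr => j _; rewrite H comp_comp subr_eq [j + i]addrC.
by case: eqP => // _; rewrite scaler0.
Qed.

Section SubQuotient.
Variables (M : grmod A) (S : submodClosed M).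
Hypothesis hS : forall i x, x \in S -> comp (gm_gr M) i x \in S.

Definition sub_comp i (x : submod_of S) : submod_of S :=
  Submod (hS i (submod_valP x)).
Fact sub_comp_additive i : zmod_morphism (sub_comp i).
Proof. by move=> x y; apply: val_inj; rewrite /= raddfB. Qed.
HB.instance Definition _ i := GRing.isZmodMorphism.Build (submod_of S)
  (submod_of S) (sub_comp i) (sub_comp_additive i).
Fact sub_comp_comp i j x :
  sub_comp i (sub_comp j x) = if i == j then sub_comp j x else 0.
Proof. by apply: val_inj; rewrite /= comp_comp; case: eqP. Qed.
Fact sub_comp_sum x :
  exists2 s : seq int, uniq s & x = \sum_(i <- s) sub_comp i x.
Proof.
have [s us xE] := comp_sum (gm_gr M) (val x); exists s => //.
by apply: val_inj; rewrite raddf_sum /= -xE.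
Qed.
Definition sub_grading : grading (submod_of S) :=
  @Grading (submod_of S) sub_comp sub_comp_comp sub_comp_sum.
Fact sub_homog i x : homog sub_grading i x <-> homog (gm_gr M) i (val x).
Proof. by split=> [/(congr1 val)|h] //; apply: val_inj. Qed.
Fact sub_act i j a x : homog (ga_gr A) i a -> homog sub_grading j x ->
  homog sub_grading (i + j) (a *: x).
Proof. by move=> ai /sub_homog xj; apply/sub_homog; rewrite linearZ; apply: gm_act. Qed.
Definition sub_grmod : grmod A := @GrMod k A (submod_of S) sub_grading sub_act.

Definition quo_comp i (x : quot_mod S) : quot_mod S :=
  quot_pi S (comp (gm_gr M) i (quot_repr x)).
Lemma quo_compE i x : quo_comp i (quot_pi S x) = quot_pi S (comp (gm_gr M) i x).
Proof. by apply/quot_piP; rewrite -raddfB hS // quot_pi_repr. Qed.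
Fact quo_comp_additive i : zmod_morphism (quo_comp i).
Proof.
move=> x y; rewrite -[x]quot_reprK -[y]quot_reprK -raddfB !quo_compE.
by rewrite !raddfB.
Qed.
HB.instance Definition _ i := GRing.isZmodMorphism.Build (quot_mod S)
  (quot_mod S) (quo_comp i) (quo_comp_additive i).
Fact quo_comp_comp i j x :
  quo_comp i (quo_comp j x) = if i == j then quo_comp j x else 0.
Proof.
rewrite -[x]quot_reprK !quo_compE comp_comp.
by case: eqP => // _; rewrite raddf0.
Qed.
Fact quo_comp_sum x :
  exists2 s : seq int, uniq s & x = \sum_(i <- s) quo_comp i x.
Proof.
have [s us xE] := comp_sum (gm_gr M) (quot_repr x); exists s => //.
rewrite -{1}[x]quot_reprK {1}xE raddf_sum /=; apply: eq_bigr => i _.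
by rewrite -quo_compE quot_reprK.
Qed.
Definition quo_grading : grading (quot_mod S) :=
  @Grading (quot_mod S) quo_comp quo_comp_comp quo_comp_sum.
Fact quo_act i j a x : homog (ga_gr A) i a -> homog quo_grading j x ->
  homog quo_grading (i + j) (a *: x).
Proof.
move=> ai xj; rewrite -xj /= /quo_comp -linearZ /homog /= quo_compE.
by congr quot_pi; apply: gm_act ai (homog_comp _ _ _).
Qed.
Definition quo_grmod : grmod A := @GrMod k A (quot_mod S) quo_grading quo_act.
End SubQuotient.

Section Suspension.
Variables (d : int) (M : grmod A).
Definition susp_comp i : {additive M -> M} := comp (gm_gr M) (i - d).
Fact susp_comp_comp i j x :
  susp_comp i (susp_comp j x) = if i == j then susp_comp j x else 0.
Proof. by rewrite /susp_comp comp_comp (inj_eq (addIr _)). Qed.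
Fact susp_comp_sum x :
  exists2 s : seq int, uniq s & x = \sum_(i <- s) susp_comp i x.
Proof.
have [s us xE] := comp_sum (gm_gr M) x; exists [seq i + d | i <- s].
  by rewrite map_inj_uniq //; apply: addIr.
by rewrite big_map {1}xE; apply: eq_bigr => i _; rewrite /susp_comp addrK.
Qed.
Definition susp_grading : grading M := Grading susp_comp_comp susp_comp_sum.
Fact susp_act i j a x : homog (ga_gr A) i a -> homog susp_grading j x ->
  homog susp_grading (i + j) (a *: x).
Proof. by move=> ai xj; rewrite /homog /= /susp_comp -addrA; apply: gm_act. Qed.
Definition susp : grmod A := @GrMod k A M susp_grading susp_act.
End Suspension.

Definition reg_grading : grading A^o := ga_gr A.
Definition reg_grmod : grmod A := @GrMod k A A^o reg_grading (@ga_mul k A).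

Record hideal := HIdeal {
  hi_set :> submodClosed reg_grmod;
  hi_comp : forall i x, x \in hi_set -> comp (gm_gr reg_grmod) i x \in hi_set }.

Definition cyclic_grmod (I : hideal) : grmod A := quo_grmod (@hi_comp I).

(* [ghom M N] is the direct sum over d of the groups of linear maps of degree d,
   i.e. of grading-preserving maps \Sigma^d M -> N. *)
Section GHom.
Variables M N : grmod A.

Definition deg_hom (d : int) (f : M -> N) : Prop :=
  linear f /\ forall i x, f (comp (gm_gr M) i x) = comp (gm_gr N) (i + d) (f x).

Definition ghom_pred : {pred M -> N} := fun f =>
  `[< exists F : int -> M -> N, (forall d, deg_hom d (F d)) /\
      exists2 s : seq int, uniq s /\ (forall d, d \notin s -> F d = 0)
        & f = \sum_(d <- s) F d >].

Lemma deg_hom0 d : deg_hom d (0 : M -> N).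
Proof. by split=> [c x y|i x]; rewrite ?scaler0 ?addr0 ?raddf0. Qed.

Lemma deg_homB d (f g : M -> N) : deg_hom d f -> deg_hom d g -> deg_hom d (f - g).
Proof.
move=> [fL fd] [gL gd]; split=> [c x y|i x].
  have E z : (f - g) z = f z - g z by [].
  by rewrite !E fL gL scalerBr opprD addrACA.
have E z : (f - g) z = f z - g z by [].
by rewrite !E fd gd raddfB.
Qed.

Lemma ghom_zmod_closed : zmod_closed ghom_pred.
Proof.
split=> [|f g /asboolP[F [Fd [s [us sF] ->]]] /asboolP[G [Gd [r [ur rG] ->]]]].
  apply/asboolP; exists (fun=> 0); split; first exact: deg_hom0.
  by exists [::]; rewrite ?big_nil.
apply/asboolP; exists (fun d => F d - G d); split=> [d|]; first exact: deg_homB.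
exists (undup (s ++ r)).
  split=> [|d]; first exact: undup_uniq.
  by rewrite mem_undup mem_cat negb_or => /andP[/sF -> /rG ->]; rewrite subr0.
rewrite big_split /= sumrN; congr (_ - _).
- rewrite [RHS](bigID (fun d => d \in s)) /= [X in _ + X]big1 => [|d /sF //]; rewrite addr0.
  rewrite -[RHS]big_filter; apply: perm_big; apply: uniq_perm; rewrite ?filter_uniq ?undup_uniq // => d.
  by rewrite mem_filter /= mem_undup mem_cat; case: (d \in s).
- rewrite [RHS](bigID (fun d => d \in r)) /= [X in _ + X]big1 => [|d /rG //]; rewrite addr0.
  rewrite -[RHS]big_filter; apply: perm_big; apply: uniq_perm; rewrite ?filter_uniq ?undup_uniq // => d.
  by rewrite mem_filter /= mem_undup mem_cat orbC; case: (d \in r).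
Qed.
HB.instance Definition _ := GRing.isZmodClosed.Build (M -> N) ghom_pred
  ghom_zmod_closed.

Record ghom := GHom { ghom_fun :> M -> N; ghom_funP : ghom_fun \in ghom_pred }.
HB.instance Definition _ := [isSub for ghom_fun].
HB.instance Definition _ := [Choice of ghom by <:].
HB.instance Definition _ := [SubChoice_isSubZmodule of ghom by <:].
End GHom.
End GrMod.


Section Derived.
Variables (k : fieldType) (A : galg k).
Implicit Types M N X Y : grmod A.

Fact grhom_id_comp M i x :
  idfun (comp (gm_gr M) i x) = comp (gm_gr M) i (idfun x).
Proof. by []. Qed.
Definition grhom_id M : grhom M M :=
  @GrHom k A M M idfun (@grhom_id_comp M).

Fact grhom_comp_comp X Y M (g : grhom Y M) (f : grhom X Y) i x :
  (g \o f) (comp (gm_gr X) i x) = comp (gm_gr M) i ((g \o f) x).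
Proof. by rewrite /= !gh_comp. Qed.
Definition grhom_comp X Y M (g : grhom Y M) (f : grhom X Y) : grhom X M :=
  @GrHom k A X M (g \o f) (grhom_comp_comp g f).

Record abfunctor := AbFunctor {
  af_obj :> grmod A -> zmodType;
  af_map : forall M N, grhom M N -> {additive af_obj M -> af_obj N};
  af_id : forall M, af_map (grhom_id M) =1 id;
  af_comp : forall X Y M (g : grhom Y M) (f : grhom X Y),
    af_map (grhom_comp g f) =1 af_map g \o af_map f }.

(* Cohomologically indexed injective resolutions
   0 -> M -> J^0 -> J^1 -> ..., with J^n = 0 for n < 0 *)
Record injres M := InjRes {
  ir_obj :> int -> grmod A;
  ir_d : forall m n, m + 1 = n -> grhom (ir_obj m) (ir_obj n);
  ir_aug : grhom M (ir_obj 0);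
  ir_inj : forall n, grinjective (ir_obj n);
  ir_neg : forall (n : int) (x : ir_obj n), n < 0 -> x = 0;
  ir_aug_inj : injective ir_aug;
  ir_exact0 : forall n (e : 0 + 1 = n) x,
    ir_d e x = 0 <-> exists y, ir_aug y = x;
  ir_exact : forall m n p (e : m + 1 = n) (e' : n + 1 = p) x, 0 < n ->
    ir_d e' x = 0 <-> exists y, ir_d e y = x }.

Record resmap M N (f : grhom M N) (J : injres M) (K : injres N) := ResMap {
  rm_fun :> forall n, grhom (J n) (K n);
  rm_d : forall m n (e : m + 1 = n) x, rm_fun n (ir_d J e x) = ir_d K e (rm_fun m x);
  rm_aug : forall x, rm_fun 0 (ir_aug J x) = ir_aug K (f x) }.

(* The n-th right derived functor of [F] at [M], computed with the injective
   resolution [J] of [M], and its effect on morphisms. *)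
Definition derived (F : abfunctor) (n : int) M (J : injres M) : zmodType :=
  cohomology (af_map F (ir_d J (subrK 1 n))) (af_map F (ir_d J (erefl (n + 1)))).

Definition derived_map (F : abfunctor) (n : int) M N (f : grhom M N)
    (J : injres M) (K : injres N) (phi : resmap f J K) :
    derived F n J -> derived F n K :=
  cohom_map _ _ (af_map F (phi n)).


Lemma ghom_linear X M (h : ghom X M) : linear h.
Proof.
have /asboolP[F [Fd [s _ ->]]] := ghom_funP h => c x y.
by rewrite !fct_sumE scaler_sumr -big_split /=; apply: eq_bigr => d _; rewrite (Fd d).1.
Qed.

Section Post.
Variables (X M N : grmod A) (g : grhom M N).
Fact ghom_postP (h : ghom X M) : (g \o h) \in @ghom_pred k A X N.
Proof.
have /asboolP[F [Fd [s [us sF] hE]]] := ghom_funP h; apply/asboolP.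
exists (fun d => g \o F d); split=> [d|].
  split=> [c x y|i x] /=; first by rewrite (Fd d).1 raddfD /= linearZ.
  by rewrite (Fd d).2 gh_comp.
exists s; first by split=> // d /sF ->; apply/funext => x /=; rewrite raddf0.
by apply/funext => x; rewrite /= hE !fct_sumE raddf_sum.
Qed.
Definition ghom_post (h : ghom X M) : ghom X N := GHom (ghom_postP h).
Fact ghom_post_additive : zmod_morphism ghom_post.
Proof. by move=> h h'; apply/val_inj/funext => x /=; rewrite raddfB. Qed.
HB.instance Definition _ := GRing.isZmodMorphism.Build (ghom X M) (ghom X N)
  ghom_post ghom_post_additive.
End Post.

Section Pre.
Variables (X Y M : grmod A) (f : grhom X Y).
Fact ghom_preP (h : ghom Y M) : (h \o f) \in @ghom_pred k A X M.
Proof.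
have /asboolP[F [Fd [s [us sF] hE]]] := ghom_funP h; apply/asboolP.
exists (fun d => F d \o f); split=> [d|].
  split=> [c x y|i x] /=; first by rewrite raddfD /= linearZ (Fd d).1.
  by rewrite gh_comp (Fd d).2.
exists s; first by split=> // d /sF ->.
by apply/funext => x; rewrite /= hE !fct_sumE.
Qed.
Definition ghom_pre (h : ghom Y M) : ghom X M := GHom (ghom_preP h).
End Pre.

Section HomFunctor.
Variable X : grmod A.
Definition hom_obj M : zmodType := ghom X M.
Definition hom_map M N (g : grhom M N) : {additive hom_obj M -> hom_obj N} :=
  @ghom_post X M N g.
Fact hom_id M : hom_map (grhom_id M) =1 id.
Proof. by move=> h; apply/val_inj/funext. Qed.
Fact hom_comp M N Y (g : grhom N Y) (f : grhom M N) :
  hom_map (grhom_comp g f) =1 hom_map g \o hom_map f.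
Proof. by move=> h; apply/val_inj/funext. Qed.
Definition hom_functor : abfunctor := AbFunctor hom_id hom_comp.
End HomFunctor.

Definition Ext (n : int) X M (J : injres M) : zmodType :=
  derived (hom_functor X) n J.
Definition Ext_pre (n : int) X Y (f : grhom X Y) M (J : injres M) :
    Ext n Y J -> Ext n X J :=
  cohom_map _ _ (ghom_pre f : ghom Y (J n) -> ghom X (J n)).
Definition Ext_map (n : int) X M N (f : grhom M N) (J : injres M) (K : injres N)
    (phi : resmap f J K) : Ext n X J -> Ext n X K :=
  derived_map (F := hom_functor X) phi.


Section GradedGen.
Variables (M : grmod A) (X : set M).
Hypothesis XP : forall i x, X x -> comp (gm_gr M) i x \in gen_submod X.

Definition gen_core : {pred M} := fun x =>
  `[< forall i, comp (gm_gr M) i x \in gen_submod X >].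
Fact gen_core_closed : submod_closed gen_core.
Proof.
split=> [|c u v /asboolP uX /asboolP vX]; apply/asboolP => i.
  by rewrite raddf0 rpred0.
have [s us cE] := comp_sum (ga_gr A) c.
rewrite raddfD /= (comp_act i u us cE) rpredD //; apply: rpred_sum => j _.
exact: rpredZ.
Qed.
HB.instance Definition _ := GRing.isSubmodClosed.Build A M gen_core gen_core_closed.

Lemma gen_submod_graded i x : x \in gen_submod X ->
  comp (gm_gr M) i x \in gen_submod X.
Proof.
have gX : {subset gen_submod X <= gen_core}.
  by apply: gen_submod_min => y Xy; apply/asboolP => j; apply: XP.
by move=> /gX /asboolP.
Qed.
End GradedGen.

Definition high (j : nat) : set (reg_grmod A) :=
  fun a => exists2 i : int, j%:Z <= i & homog (ga_gr A) i a.
Fact high_comp j i x : x \in gen_submod (high j) ->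
  comp (gm_gr (reg_grmod A)) i x \in gen_submod (high j).
Proof.
apply: gen_submod_graded => {}i {}x [i' ji' xi'].
rewrite (comp_homog _ xi'); case: eqP => _; last exact: rpred0.
by apply: mem_gen_submod; exists i'.
Qed.
(* The left ideal I_j generated by the homogeneous elements of degree >= j *)
Definition highI (j : nat) : hideal A := HIdeal (@high_comp j).

Lemma highI_sub j : {subset highI j.+1 <= highI j}.
Proof.
apply: gen_submod_min => x [i ji xi]; apply: mem_gen_submod; exists i => //.
by apply: Order.POrderTheory.le_trans ji; rewrite lez_nat.
Qed.

Section CyclicMap.
Variables (I J : hideal A) (IJ : {subset I <= J}).
Definition cyclic_fun (q : cyclic_grmod I) : cyclic_grmod J :=
  quot_pi J (quot_repr q).
Lemma cyclic_funE x : cyclic_fun (quot_pi I x) = quot_pi J x.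
Proof. by apply/quot_piP/IJ/quot_pi_repr. Qed.
Fact cyclic_fun_additive : zmod_morphism cyclic_fun.
Proof.
move=> x y; rewrite -[x]quot_reprK -[y]quot_reprK -raddfB !cyclic_funE.
by rewrite raddfB.
Qed.
Fact cyclic_fun_scalable : scalable cyclic_fun.
Proof. by move=> c x; rewrite -[x]quot_reprK -linearZ !cyclic_funE linearZ. Qed.
HB.instance Definition _ := GRing.isZmodMorphism.Build (cyclic_grmod I)
  (cyclic_grmod J) cyclic_fun cyclic_fun_additive.
HB.instance Definition _ := GRing.isScalable.Build A (cyclic_grmod I)
  (cyclic_grmod J) *:%R cyclic_fun cyclic_fun_scalable.
Fact cyclic_fun_comp i x : cyclic_fun (comp (gm_gr (cyclic_grmod I)) i x) =
  comp (gm_gr (cyclic_grmod J)) i (cyclic_fun x).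
Proof.
rewrite -[x]quot_reprK cyclic_funE /= !quo_compE ?cyclic_funE //; exact: hi_comp.
Qed.
(* The projection A/I -> A/J; [cyclic_fun] computes it on representatives. *)
Definition cyclic_map : grhom (cyclic_grmod I) (cyclic_grmod J) :=
  @GrHom k A _ _ cyclic_fun cyclic_fun_comp.
End CyclicMap.

Definition colim_Ext (n : int) M (J : injres M) : zmodType :=
  colim (fun j => Ext_pre (n := n) (cyclic_map (@highI_sub j)) (J := J)).
Definition colim_Ext_map (n : int) M N (f : grhom M N) (J : injres M)
    (K : injres N) (phi : resmap f J K) : colim_Ext n J -> colim_Ext n K :=
  @colim_map _ _ _ _ (fun j => Ext_map (n := n) (X := cyclic_grmod (highI j)) phi).
End Derived.


Section TensorMaps.
Variables (k : fieldType) (U V W : lmodType k).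

Definition tmap (U' V' : lmodType k) (f : U -> U') (g : V -> V') :
    tensor U V -> tensor U' V' :=
  tlift (fun u v => tens (f u) (g v)).

Definition tassoc : tensor (tensor U V) W -> tensor U (tensor V W) :=
  tlift (fun t w => tlift (fun u v => tens u (tens v w)) t).
End TensorMaps.

(* The degree-[n] part of the tensor product of graded vector spaces *)
Definition tensor_homog (k : fieldType) (V W : gvect k) (n : int) :
    {pred tensor V W} :=
  gen_submod (fun t => exists i j v w, [/\ i + j = n, homog (gv_gr V) i v,
                                     homog (gv_gr W) j w & t = tens v w]).

(* Nonzero graded coalgebras, just as the objects of [algType] are nonzero *)
Record gcoalg (k : fieldType) := GCoalg {
  gc_vect :> gvect k;
  gc_delta : {linear gc_vect -> tensor gc_vect gc_vect};
  gc_eps : {scalar gc_vect};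
  gc_coassoc : forall c, tassoc (tmap gc_delta id (gc_delta c)) =
                         tmap id gc_delta (gc_delta c);
  gc_counitl : forall c, tlift (fun a b => gc_eps a *: b) (gc_delta c) = c;
  gc_counitr : forall c, tlift (fun a b => gc_eps b *: a) (gc_delta c) = c;
  gc_delta_homog : forall n c, homog (gv_gr gc_vect) n c ->
    gc_delta c \in @tensor_homog k gc_vect gc_vect n;
  gc_eps_homog : forall n c, n != 0 -> homog (gv_gr gc_vect) n c -> gc_eps c = 0;
  gc_nonzero : exists c : gc_vect, c != 0 }.

Definition finite_type (k : fieldType) (V : gvect k) : Prop :=
  forall n, fin_dim (homog (gv_gr V) n).

Definition connected_coalg (k : fieldType) (C : gcoalg k) : Prop :=
  (forall (n : int) x, 0 < n -> homog (gv_gr C) n x -> x = 0) /\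
  one_dim (homog (gv_gr C) 0).

Record grcomod (k : fieldType) (C : gcoalg k) := GrComod {
  cm_vect :> gvect k;
  cm_psi : {linear cm_vect -> tensor C cm_vect};
  cm_coassoc : forall m, tassoc (tmap (gc_delta C) id (cm_psi m)) =
                         tmap id cm_psi (cm_psi m);
  cm_counit : forall m, tlift (fun c x => gc_eps C c *: x) (cm_psi m) = m;
  cm_homog : forall n m, homog (gv_gr cm_vect) n m ->
    cm_psi m \in @tensor_homog k C cm_vect n }.

Definition reg_comod (k : fieldType) (C : gcoalg k) : grcomod C :=
  @GrComod k C C (gc_delta C) (@gc_coassoc k C) (@gc_counitl k C)
    (@gc_delta_homog k C).

Section ComodCategory.
Variables (k : fieldType) (C : gcoalg k).

Record comod_hom (M N : grcomod C) := ComodHom {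
  ch_fun :> {linear M -> N};
  ch_comp : forall i x, ch_fun (comp (gv_gr M) i x) = comp (gv_gr N) i (ch_fun x);
  ch_psi : forall x, cm_psi N (ch_fun x) = tmap id ch_fun (cm_psi M x) }.

Definition comod_epi (M N : grcomod C) (f : comod_hom M N) : Prop :=
  forall Z (u v : comod_hom N Z), (forall x, u (f x) = v (f x)) -> u =1 v.

Definition comod_projective (P : grcomod C) : Prop :=
  forall (M N : grcomod C) (p : comod_hom M N), comod_epi p ->
    forall f : comod_hom P N, exists g : comod_hom P M, forall x, p (g x) = f x.
End ComodCategory.

Section Action.
Variables (k : fieldType) (C : gcoalg k).
Implicit Type M : grcomod C.

Lemma lin_comp (U V W : lmodType k) (f : V -> W) (g : U -> V) :
  linear f -> linear g -> linear (fun x => f (g x)).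
Proof. by move=> fL gL a x y; rewrite gL fL. Qed.

Lemma lin_id (U : lmodType k) : linear (@id U). Proof. by []. Qed.

Lemma lin_scale (U : lmodType k) (f : U -> k^o) (V : lmodType k) (v : V) :
  linear f -> linear (fun u => (f u : k) *: v).
Proof. by move=> fL a x y; rewrite fL scalerDl scalerA. Qed.

Lemma tens_linl (V W : lmodType k) (w : W) : linear (fun v : V => tens v w).
Proof. exact: (tens_bilin V W).1. Qed.
Lemma tens_linr (V W : lmodType k) (v : V) : linear (fun w : W => tens v w).
Proof. exact: (tens_bilin V W).2. Qed.

Lemma tmap_bilin (U U' V V' : lmodType k) (f : U -> U') (g : V -> V') :
  linear f -> linear g -> bilin (fun u v => tens (f u) (g v)).
Proof.
by move=> fL gL; split=> [v|u]; [exact: lin_comp (tens_linl _) fL | exact: lin_comp (tens_linr _) gL].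
Qed.

Lemma tmap_linear (U U' V V' : lmodType k) (f : U -> U') (g : V -> V') :
  linear f -> linear g -> linear (tmap f g).
Proof. by move=> fL gL; exact: tlift_linear (tmap_bilin fL gL). Qed.

Lemma tmap_tens (U U' V V' : lmodType k) (f : U -> U') (g : V -> V') u v :
  linear f -> linear g -> tmap f g (tens u v) = tens (f u) (g v).
Proof. by move=> fL gL; exact: (tlift_tens (tmap_bilin fL gL)). Qed.

Section Assoc.
Variables U V W : lmodType k.
Lemma tassoc_bilin1 (w : W) : bilin (fun (u : U) (v : V) => tens u (tens v w)).
Proof.
by split=> [v|u]; [exact: tens_linl | exact: lin_comp (tens_linr _) (tens_linl _)].
Qed.
Lemma tassoc_bilin2 : bilin (fun (t : tensor U V) (w : W) =>
  tlift (fun u v => tens u (tens v w)) t).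
Proof.
split=> [w|t a w w']; first exact: tlift_linear (tassoc_bilin1 w).
move: t; apply: tensor_ext; first exact: tlift_linear (tassoc_bilin1 _).
  move=> c s t; rewrite !(tlift_linear (tassoc_bilin1 _)).
  by rewrite !scalerDr !scalerA [a * c]mulrC addrACA.
move=> u v; rewrite !(tlift_tens (tassoc_bilin1 _)).
by rewrite (tens_linr v) (tens_linr u).
Qed.
Lemma tassoc_linear : linear (@tassoc k U V W).
Proof. exact: tlift_linear tassoc_bilin2. Qed.
Lemma tassoc_tens u v w : tassoc (tens (tens u v) w) = tens u (tens v w) :> tensor U (tensor V W).
Proof. by rewrite /tassoc (tlift_tens tassoc_bilin2) (tlift_tens (tassoc_bilin1 w)). Qed.
End Assoc.

Section Kill.
Variables (V W : gvect k) (U : lmodType k) (h : V -> W -> U).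
Hypothesis hB : bilin h.
Definition tker : {pred tensor V W} := fun t => tlift h t == 0.
Fact tker_closed : submod_closed tker.
Proof.
have h0 : tlift h 0 = 0.
  by apply: (addIr (tlift h 0)); have := tlift_linear hB 1 0 0; rewrite !scale1r !add0r.
split=> [|c t u]; rewrite -!topredE /= /tker ?h0 // (tlift_linear hB).
by move=> /eqP -> /eqP ->; rewrite scaler0 addr0.
Qed.
HB.instance Definition _ := GRing.isSubmodClosed.Build k (tensor V W) tker tker_closed.

Lemma tlift_kill n t :
  (forall i j v w, i + j = n -> homog (gv_gr V) i v ->
    homog (gv_gr W) j w -> h v w = 0) ->
  t \in @tensor_homog k V W n -> tlift h t = 0.
Proof.
move=> h0 tn; apply/eqP; move: t tn.
suff : {subset @tensor_homog k V W n <= tker} by move=> H t /H.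
apply: gen_submod_min => _ [i [j [v [w [ij vi wj ->]]]]].
by rewrite -topredE /= /tker (tlift_tens hB) (h0 i j).
Qed.
End Kill.

(* (f \otimes id_M) (psi m), i.e. the action f . m *)
Definition dact M (f : C -> k^o) (m : M) : M :=
  tlift (fun c x => f c *: x) (cm_psi M m).

(* The product for which [dact] is a left action.  No Koszul sign is used;
   rescaling degree n by (-1)^(n(n-1)/2) is an isomorphism onto the graded
   algebra with signs. *)
Definition dmul (f g : C -> k^o) (c : C) : k^o :=
  tlift (fun a b => g a * f b : k^o) (gc_delta C c).

Lemma dact_bilin M (f : C -> k^o) : linear f ->
  bilin (fun (c : C) (x : M) => f c *: x).
Proof.
move=> fL; split=> [x a c c'|c a x y]; first by rewrite fL scalerDl scalerA.
by rewrite scalerDr !scalerA mulrC.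
Qed.

Lemma dmul_bilin (f g : C -> k^o) : linear f -> linear g ->
  bilin (fun a b : C => g a * f b : k^o).
Proof.
move=> fL gL; split=> [b c a a'|a c b b'].
  by rewrite gL mulrDl -mulrA.
by rewrite fL mulrDr mulrCA.
Qed.

Lemma dact_linear M (f : C -> k^o) : linear f -> linear (dact (M := M) f).
Proof.
move=> fL a x y; rewrite /dact linearP /=; exact: tlift_linear (dact_bilin M fL) _ _ _.
Qed.

Lemma dmul_linear (f g : C -> k^o) : linear f -> linear g -> linear (dmul f g).
Proof.
move=> fL gL a x y; rewrite /dmul linearP /=.
exact: tlift_linear (dmul_bilin fL gL) _ _ _.
Qed.

Lemma dact_comb M (f g : C -> k^o) (a : k) (m : M) : linear f -> linear g ->
  dact (a *: f + g) m = a *: dact f m + dact g m.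
Proof.
move=> fL gL; rewrite /dact; move: (cm_psi M m).
have cL : linear (a *: f + g).
  by move=> b x y; rewrite /= !scalrfctE !addrfctE fL gL !scalerDr addrACA !scalerA [a * b]mulrC.
apply: tensor_ext; first exact: tlift_linear (dact_bilin M cL).
  move=> c s t; rewrite (tlift_linear (dact_bilin M fL)) (tlift_linear (dact_bilin M gL)).
  by rewrite !scalerDr !scalerA [a * c]mulrC addrACA.
move=> c x; rewrite (tlift_tens (dact_bilin M cL)) (tlift_tens (dact_bilin M fL)).
by rewrite (tlift_tens (dact_bilin M gL)) scalerA -scalerDl.
Qed.

Lemma dact_mul M (f g : C -> k^o) (m : M) : linear f -> linear g ->
  dact (dmul f g) m = dact f (dact g m).
Proof.
move=> fL gL; have fB := dact_bilin M fL; have gB := dact_bilin M gL.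
have fgL := dmul_linear fL gL; have fgB := dmul_bilin fL gL.
have psiL : linear (cm_psi M) by exact: linearP.
have dL : linear (gc_delta C) by exact: linearP.
pose L := tlift (fun (c : C) (w : tensor C M) => g c *: tlift (fun c' (x : M) => f c' *: x) w).
pose L' := tlift (fun (s : tensor C C) (x : M) => (tlift (fun a b => g a * f b : k^o) s : k) *: x).
have LB : bilin (fun (c : C) (w : tensor C M) => g c *: tlift (fun c' (x : M) => f c' *: x) w).
  split=> [w|c b w w']; first exact: lin_scale.
  by rewrite (tlift_linear fB) scalerDr !scalerA mulrC.
have LB' : bilin (fun (s : tensor C C) (x : M) => (tlift (fun a b => g a * f b : k^o) s : k) *: x).
  split=> [x|s b x y]; first by apply: lin_scale; exact: tlift_linear.
  by rewrite scalerDr !scalerA mulrC.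
have E1 t : tlift (fun c (x : M) => dmul f g c *: x) t = L' (tmap (gc_delta C) id t).
  move: t; apply: tensor_ext; first exact: tlift_linear (dact_bilin M fgL).
    by apply: lin_comp; [exact: tlift_linear | apply: tmap_linear].
  move=> c x; rewrite (tlift_tens (dact_bilin M fgL)) tmap_tens //.
  by rewrite /L' (tlift_tens LB').
have E2 t : L' t = L (tassoc t).
  move: t; apply: tensor_ext; first exact: tlift_linear.
    by apply: lin_comp; [exact: tlift_linear | exact: tassoc_linear].
  move=> s x; rewrite /L' (tlift_tens LB'); move: s; apply: tensor_ext.
  - by apply: lin_scale; exact: tlift_linear.
  - apply: (@lin_comp _ _ _ L); first exact: tlift_linear.
    by apply: (@lin_comp _ _ _ (@tassoc k C C M)); [exact: tassoc_linear | exact: tens_linl].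
  - move=> a b; rewrite (tlift_tens fgB) tassoc_tens /L (tlift_tens LB) (tlift_tens fB).
    by rewrite scalerA.
have E3 t : L (tmap id (cm_psi M) t) = dact f (tlift (fun c (x : M) => g c *: x) t).
  move: t; apply: tensor_ext.
  - by apply: lin_comp; [exact: tlift_linear | apply: tmap_linear].
  - by apply: lin_comp; [exact: dact_linear | exact: tlift_linear].
  - by move=> c x; rewrite tmap_tens // /L (tlift_tens LB) (tlift_tens gB)
      [in RHS](scalable_linear (dact_linear fL)).
by rewrite /dact E1 E2 cm_coassoc E3.
Qed.

Lemma dact_one M (m : M) : dact (gc_eps C) m = m.
Proof. exact: cm_counit. Qed.

Lemma eps_dact (f : C -> k^o) (c : C) : linear f ->
  gc_eps C (dact (M := reg_comod C) f c) = f c.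
Proof.
move=> fL; have fB := dact_bilin (reg_comod C) fL.
have eB : bilin (fun a b : C => gc_eps C b *: a).
  split=> [b|a b x y]; first by move=> d x y; rewrite scalerDr !scalerA mulrC.
  by rewrite linearP scalerDl scalerA.
suff E t : gc_eps C (tlift (fun a b : C => f a *: b) t) =
    f (tlift (fun a b : C => gc_eps C b *: a) t) :> k.
  by rewrite -[in RHS](gc_counitr c); apply: E.
move: t; apply: (@tensor_ext _ _ _ k^o).
- by move=> a x y; rewrite (tlift_linear fB) linearP.
- by apply: lin_comp; [exact: fL | exact: tlift_linear].
- move=> a b; rewrite (tlift_tens fB) (tlift_tens eB) linearZ /=.
  by rewrite (scalable_linear fL) mulrC.
Qed.
End Action.


Section Dual.
Variables (k : fieldType) (C : gcoalg k).

Definition dual_pred : {pred C -> k^o} := fun f =>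
  `[< linear f /\ exists s : seq int, forall i, i \notin s ->
        forall c, f (comp (gv_gr C) i c) = 0 >].

Lemma dual_closed : submod_closed dual_pred.
Proof.
split=> [|a f g /asboolP[fL [s sf]] /asboolP[gL [r rg]]]; apply/asboolP.
  by split; [move=> a x y; rewrite scaler0 addr0 | exists [::]].
split.
  by move=> b x y; rewrite /= !scalrfctE !addrfctE fL gL !scalerDr addrACA !scalerA [a * b]mulrC.
exists (s ++ r) => i; rewrite mem_cat negb_or => /andP[/sf fi /rg gi] c.
by rewrite !addrfctE !scalrfctE fi gi scaler0 addr0.
Qed.
HB.instance Definition _ := GRing.isSubmodClosed.Build k (C -> k^o) dual_pred dual_closed.

(* The graded dual of [C]: sums of functionals on the C_n *)
Record dual := Dual { dual_fun :> C -> k^o; dual_funP : dual_fun \in dual_pred }.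
HB.instance Definition _ := [isSub for dual_fun].
HB.instance Definition _ := [Choice of dual by <:].
HB.instance Definition _ := GRing.SubChoice_isSubLmodule.Build k (C -> k^o)
  (fun f => f \in dual_pred) dual (GRing.subsemimodClosedP dual_pred).

Lemma dual_linear (f : dual) : linear f.
Proof. by have /asboolP[] := dual_funP f. Qed.

Lemma dual0 (f : dual) : f 0 = 0.
Proof.
apply: (addIr (f 0)); have := dual_linear f 1 0 0.
by rewrite !scale1r !add0r => <-.
Qed.

Lemma dual_eq (f g : dual) : f =1 g -> f = g.
Proof. by move=> fg; apply/val_inj/funext. Qed.

Lemma dual_support (f : dual) : exists2 s : seq int, uniq s &
  forall i, i \notin s -> forall c, f (comp (gv_gr C) i c) = 0.
Proof.
have /asboolP[_ [s sf]] := dual_funP f; exists (undup s); first exact: undup_uniq.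
by move=> i; rewrite mem_undup; apply: sf.
Qed.

Fact dual_mul_subproof (f g : dual) : dmul f g \in dual_pred.
Proof.
apply/asboolP; split; first by apply: dmul_linear; exact: dual_linear.
have [s _ sf] := dual_support f; have [r _ rg] := dual_support g.
exists [seq i + j | i <- r, j <- s] => n nsr c.
rewrite /dmul; apply: (tlift_kill _ (n := n)).
- by apply: dmul_bilin; exact: dual_linear.
- move=> i j v w ij vi wj; have [ir|/rg gi] := boolP (i \in r); last first.
    by rewrite -vi gi mul0r.
  have [js|/sf fj] := boolP (j \in s); last by rewrite -wj fj mulr0.
  by case/negP: nsr; apply/allpairsP; exists (i, j); split.
- by apply: gc_delta_homog; apply: homog_comp.
Qed.
Definition dual_mul (f g : dual) : dual := Dual (dual_mul_subproof f g).

Fact dual_one_subproof : (gc_eps C : C -> k^o) \in dual_pred.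
Proof.
apply/asboolP; split; first exact: linearP.
exists [:: 0] => i; rewrite inE => i0 c.
by rewrite [LHS](gc_eps_homog i0 (homog_comp (gv_gr C) i c)).
Qed.
Definition dual_one : dual := Dual dual_one_subproof.

(* [C] is a faithful module over its dual, so the ring axioms follow from those
   of the action. *)
Local Notation act f c := (@dact k C (reg_comod C) f c).

Lemma act_inj (f g : dual) : (forall c, act f c = act g c) -> f = g.
Proof.
move=> fg; apply: dual_eq => c.
by rewrite -(eps_dact c (dual_linear f)) -(eps_dact c (dual_linear g)) fg.
Qed.

Lemma act_mul (f g : dual) c : act (dual_mul f g) c = act f (act g c).
Proof. by apply: dact_mul; exact: dual_linear. Qed.

Lemma act_one c : act dual_one c = c.
Proof. exact: (dact_one (M := reg_comod C)). Qed.

Lemma act_comb a (f g : dual) c : act (a *: f + g : dual) c = a *: act f c + act g c.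
Proof. by apply: (dact_comb (M := reg_comod C)); exact: dual_linear. Qed.

Lemma act_add (f g : dual) c : act (f + g : dual) c = act f c + act g c.
Proof. by rewrite -[f in LHS]scale1r act_comb scale1r. Qed.

Lemma act_scale a (f : dual) c : act (a *: f : dual) c = a *: act f c.
Proof.
rewrite -[a *: f]addr0 act_comb; apply/(addrI (- (a *: act f c))).
rewrite addKr addNr; apply: (addIr (act (0 : dual) c)).
by rewrite -act_add !add0r.
Qed.

Lemma act_addr (f : dual) c d : act f (c + d) = act f c + act f d.
Proof.
by have := @dact_linear _ _ (reg_comod C) _ (dual_linear f) 1 c d; rewrite !scale1r.
Qed.

Fact dual_mulA : associative dual_mul.
Proof. by move=> f g h; apply: act_inj => c; rewrite !act_mul. Qed.
Fact dual_mul1l : left_id dual_one dual_mul.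
Proof. by move=> f; apply: act_inj => c; rewrite act_mul act_one. Qed.
Fact dual_mul1r : right_id dual_one dual_mul.
Proof. by move=> f; apply: act_inj => c; rewrite act_mul act_one. Qed.
Fact dual_mulDl : left_distributive dual_mul +%R.
Proof. by move=> f g h; apply: act_inj => c; rewrite act_add !act_mul act_add. Qed.
Fact dual_mulDr : right_distributive dual_mul +%R.
Proof.
by move=> f g h; apply: act_inj => c; rewrite act_add !act_mul act_add act_addr.
Qed.
Fact dual_one_neq0 : dual_one != 0.
Proof.
have [c c0] := gc_nonzero C; apply: contraNneq c0 => e0.
by rewrite -[c]act_one e0 -(scale0r (0 : dual)) act_scale scale0r.
Qed.
HB.instance Definition _ := GRing.Zmodule_isNzRing.Build dual
  dual_mulA dual_mul1l dual_mul1r dual_mulDl dual_mulDr dual_one_neq0.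

Fact dual_scaleAl (a : k) (f g : dual) : a *: (f * g) = (a *: f) * g.
Proof. by apply: act_inj => c; rewrite act_scale [LHS]/= !act_mul act_scale. Qed.
HB.instance Definition _ := GRing.Lmodule_isLalgebra.Build k dual dual_scaleAl.
Fact dual_scaleAr (a : k) (f g : dual) : a *: (f * g) = f * (a *: g).
Proof.
apply: act_inj => c; rewrite act_scale !act_mul act_scale.
by rewrite (scalable_linear (dact_linear (dual_linear f))).
Qed.
HB.instance Definition _ := GRing.Lalgebra_isAlgebra.Build k dual dual_scaleAr.

(* A functional on C_n has degree -n. *)
Fact dual_comp_subproof i (f : dual) :
  (fun c => f (comp (gv_gr C) (- i) c)) \in dual_pred.
Proof.
apply/asboolP; split.
  by move=> a x y; rewrite raddfD /= gv_scale dual_linear.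
exists [:: - i] => j; rewrite inE => ji c.
rewrite comp_comp eq_sym (negbTE ji).
exact: dual0.
Qed.
Definition dual_comp i (f : dual) : dual := Dual (dual_comp_subproof i f).
Fact dual_comp_additive i : zmod_morphism (dual_comp i).
Proof. by move=> f g; apply: dual_eq. Qed.
HB.instance Definition _ i := GRing.isZmodMorphism.Build dual dual (dual_comp i)
  (dual_comp_additive i).
Fact dual_comp_comp i j f :
  dual_comp i (dual_comp j f) = if i == j then dual_comp j f else 0.
Proof.
apply: dual_eq => c; rewrite /= comp_comp (inj_eq oppr_inj) eq_sym.
case: eqP => [<-//|_] /=.
exact: dual0.
Qed.

Lemma dual_sum (I : Type) (r : seq I) (F : I -> dual) c :
  (\sum_(i <- r) F i) c = \sum_(i <- r) F i c.
Proof. by elim: r => [|i r IH]; rewrite ?big_nil // !big_cons -IH. Qed.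

Lemma dual_sumr (f : dual) (I : Type) (r : seq I) (F : I -> C) :
  f (\sum_(i <- r) F i) = \sum_(i <- r) f (F i).
Proof.
have fD x y : f (x + y) = f x + f y.
  by have := dual_linear f 1 x y; rewrite !scale1r.
by rewrite (big_morph f fD (dual0 f)).
Qed.

Lemma dual_one_comp (f : dual) N c :
  (forall n, n != N -> f (comp (gv_gr C) n c) = 0) ->
  f c = f (comp (gv_gr C) N c).
Proof.
move=> f0; have [s us cE] := comp_sum (gv_gr C) c.
rewrite {1}cE dual_sumr; have [Ns|Ns] := boolP (N \in s).
  by rewrite (bigD1_seq N) //= big1 ?addr0.
rewrite big_seq big1 => [|i si]; last first.
  by apply: f0; apply: contraNneq Ns => <-.
rewrite cE raddf_sum /= big_seq big1 ?dual0 // => i si.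
by rewrite comp_comp; case: eqP => // Ni; rewrite Ni si in Ns.
Qed.

Fact dual_comp_sum f :
  exists2 s : seq int, uniq s & f = \sum_(i <- s) dual_comp i f.
Proof.
have [s us sf] := dual_support f; exists [seq - i | i <- s].
  by rewrite map_inj_uniq //; exact: oppr_inj.
apply: dual_eq => c; rewrite big_map dual_sum /=.
under eq_bigr do rewrite opprK.
have [r ur cE] := comp_sum (gv_gr C) c.
have E t : uniq t -> {subset s <= t} ->
    \sum_(i <- s) f (comp (gv_gr C) i c) = \sum_(i <- t) f (comp (gv_gr C) i c).
  move=> ut st; rewrite [RHS](bigID (fun i => i \in s)) /=.
  rewrite [X in _ + X]big1 => [|i /sf //]; rewrite addr0 -[RHS]big_filter.
  apply: perm_big; apply: uniq_perm; rewrite ?filter_uniq // => i.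
  by rewrite mem_filter /=; case: (boolP (i \in s)) => // /st ->.
rewrite {1}cE dual_sumr (E (undup (s ++ r))) ?undup_uniq //; last first.
  by move=> i si; rewrite mem_undup mem_cat si.
rewrite [RHS](bigID (fun i => i \in r)) /= [X in _ + X]big1 => [|i ir].
  rewrite addr0 -[RHS]big_filter; apply: perm_big; apply: uniq_perm => //.
    by rewrite filter_uniq ?undup_uniq.
  by move=> i; rewrite mem_filter /= mem_undup mem_cat orbC; case: (i \in r).
rewrite cE raddf_sum /= big_seq big1 ?dual0 // => j jr.
by rewrite comp_comp; case: eqP => // ij; rewrite ij jr in ir.
Qed.

Definition dual_grading : grading dual :=
  @Grading dual dual_comp dual_comp_comp dual_comp_sum.

Fact dual_scale i a (f : dual) :
  comp dual_grading i (a *: f) = a *: comp dual_grading i f.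
Proof. exact: dual_eq. Qed.

Lemma dual_homog i (f : dual) : homog dual_grading i f ->
  forall c n, n != - i -> homog (gv_gr C) n c -> f c = 0.
Proof.
move=> fi c n ni cn; rewrite -fi /= -cn comp_comp eq_sym (negbTE ni).
exact: dual0.
Qed.

Lemma dact_homog (M : grcomod C) i j (f : dual) (m : M) :
  homog dual_grading i f -> homog (gv_gr M) j m ->
  homog (gv_gr M) (i + j) (dact f m).
Proof.
move=> fi mj; have fB := dact_bilin M (dual_linear f).
have hB : bilin (fun (c : C) (x : M) =>
    (f c : k) *: (comp (gv_gr M) (i + j) x - x)).
  split=> [x|c a x y]; first by apply: lin_scale; exact: dual_linear.
  rewrite [comp _ _ (_ + _)]raddfD gv_scale opprD addrACA -scalerBr scalerDr !scalerA.
  by congr (_ *: _ + _); rewrite mulrC.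
rewrite /homog; apply/eqP; rewrite -subr_eq0; apply/eqP.
transitivity (tlift (fun (c : C) (x : M) =>
    (f c : k) *: (comp (gv_gr M) (i + j) x - x)) (cm_psi M m)).
  rewrite /dact; move: (cm_psi M m); apply: tensor_ext.
  - move=> a s t; rewrite !(tlift_linear fB) [comp _ _ (_ + _)]raddfD gv_scale.
    by rewrite opprD addrACA scalerBr.
  - exact: tlift_linear.
  - by move=> c x; rewrite (tlift_tens fB) (tlift_tens hB) gv_scale scalerBr.
apply: (tlift_kill hB (n := j)); last exact: cm_homog.
move=> p q c x pq cp xq; have [pi|pi] := eqVneq p (- i); last first.
  by rewrite (dual_homog fi pi cp) scale0r.
have -> : i + j = q by rewrite -pq pi addNKr.
by rewrite xq subrr scaler0.
Qed.

Fact dual_grade_one : homog dual_grading 0 1.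
Proof.
apply: dual_eq => c /=; rewrite oppr0; symmetry.
by apply: (@dual_one_comp dual_one) => n n0; rewrite [LHS](gc_eps_homog n0 (homog_comp (gv_gr C) n c)).
Qed.

Fact dual_grade_mul i j (f g : dual) : homog dual_grading i f ->
  homog dual_grading j g -> homog dual_grading (i + j) (f * g).
Proof.
move=> fi gj; apply: dual_eq => c; symmetry; apply: dual_one_comp => n nij.
have nz : i + (j + n) != 0 by rewrite addrA addrC addr_eq0.
have H : homog (gv_gr C) (i + (j + n))
    (dact (M := reg_comod C) f (dact (M := reg_comod C) g (comp (gv_gr C) n c))).
  by do 2 apply: (dact_homog (M := reg_comod C)) => //; exact: homog_comp.
have := gc_eps_homog nz H; rewrite -act_mul => E.
by have := eps_dact (comp (gv_gr C) n c) (dual_linear (dual_mul f g)); rewrite [LHS]E.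
Qed.

Definition dual_galg : galg k :=
  @GAlg k dual dual_grading dual_scale dual_grade_one dual_grade_mul.
End Dual.

Section Iota.
Variables (k : fieldType) (C : gcoalg k) (M : grcomod C).

Definition iota_car : Type := M.
HB.instance Definition _ := GRing.Zmodule.on iota_car.
Definition iota_act (f : dual C) (m : iota_car) : iota_car := dact (M := M) f m.
Fact iota_actA f g m : iota_act f (iota_act g m) = iota_act (f * g) m.
Proof. by symmetry; apply: dact_mul; exact: dual_linear. Qed.
Fact iota_act1 : left_id 1 iota_act.
Proof. exact: dact_one. Qed.
Fact iota_actDr : right_distributive iota_act +%R.
Proof.
by move=> f m n; have := @dact_linear _ _ M _ (dual_linear f) 1 m n; rewrite !scale1r.
Qed.
Fact iota_actDl m : {morph iota_act^~ m : f g / f + g}.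
Proof.
move=> f g; have := @dact_comb _ _ M _ _ 1 m (dual_linear f) (dual_linear g).
by rewrite !scale1r.
Qed.
HB.instance Definition _ := GRing.Zmodule_isLmodule.Build (dual C) iota_car
  iota_actA iota_act1 iota_actDr iota_actDl.

Definition iota_grading : grading iota_car := gv_gr M.
Fact iota_act_homog i j (f : dual_galg C) (m : iota_car) :
  homog (ga_gr (dual_galg C)) i f -> homog iota_grading j m ->
  homog iota_grading (i + j) (f *: m).
Proof. exact: dact_homog. Qed.
Definition iota_grmod : grmod (dual_galg C) :=
  @GrMod k (dual_galg C) iota_car iota_grading iota_act_homog.
End Iota.

Section Distinguished.
Variables (k : fieldType) (C : gcoalg k).
Local Notation A := (dual_galg C).

Definition strongly_distinguished (I : hideal A) : Prop :=
  exists (d : int) (S : submodClosed (iota_grmod (reg_comod C)))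
    (hS : forall i x, x \in S ->
       comp (gm_gr (iota_grmod (reg_comod C))) i x \in S)
    (f : grhom (susp d (cyclic_grmod I)) (sub_grmod hS)), bijective f.

Definition distinguished (I : hideal A) : Prop :=
  exists n (K : 'I_n -> hideal A), (forall i, strongly_distinguished (K i)) /\
    forall a : A, (forall i, a \in K i) -> a \in I.

Definition h0_dist (M : grmod A) : set M := fun x =>
  exists2 I : hideal A, distinguished I & forall a : A, a \in I -> a *: x = 0.

Lemma h0_dist_comp (M : grmod A) i x : h0_dist x ->
  h0_dist (comp (gm_gr M) i x).
Proof.
move=> [I dI Ix]; exists I => // a aI.
have [s us aE] := comp_sum (ga_gr A) a.
rewrite aE scaler_suml big1 // => j _.
pose b := comp (ga_gr A) j a.
have bE : b = \sum_(l <- [:: j]) comp (ga_gr A) l b.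
  by rewrite big_seq1 /b comp_comp eqxx.
have := comp_act (j + i) x (isT : uniq [:: j]) bE.
rewrite big_seq1 /b comp_comp eqxx [j + i]addrC addrK => <-.
by rewrite Ix ?raddf0 //; exact: (@hi_comp _ _ I j).
Qed.

Definition H0_pred (M : grmod A) : submodClosed M := gen_submod (@h0_dist M).
Fact H0_comp (M : grmod A) i x : x \in H0_pred M ->
  comp (gm_gr M) i x \in H0_pred M.
Proof.
apply: gen_submod_graded => {}i {}x hx.
by apply: mem_gen_submod; apply: h0_dist_comp.
Qed.
Definition H0_dist (M : grmod A) : grmod A := sub_grmod (@H0_comp M).

Section Map.
Variables (M N : grmod A) (g : grhom M N).
Definition H0_preim : {pred M} := fun x => g x \in H0_pred N.
Fact H0_preim_closed : submod_closed H0_preim.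
Proof.
split=> [|c u v]; rewrite -!topredE /= /H0_preim ?raddf0 ?rpred0 // => gu gv.
by rewrite raddfD /= linearZ /= rpredD // rpredZ.
Qed.
HB.instance Definition _ := GRing.isSubmodClosed.Build A M H0_preim H0_preim_closed.

Fact H0_map_subproof (x : H0_dist M) : g (val x) \in H0_pred N.
Proof.
suff H : {subset H0_pred M <= H0_preim} by have := H _ (valP x).
apply: gen_submod_min => y [I dI Iy]; apply: mem_gen_submod; exists I => // a aI.
by rewrite -linearZ Iy // raddf0.
Qed.
Definition H0_fun (x : H0_dist M) : H0_dist N := Submod (H0_map_subproof x).
Fact H0_fun_additive : zmod_morphism H0_fun.
Proof. by move=> x y; apply: val_inj; rewrite /= raddfB. Qed.
Fact H0_fun_scalable : scalable H0_fun.
Proof. by move=> c x; apply: val_inj; rewrite /= linearZ. Qed.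
HB.instance Definition _ := GRing.isZmodMorphism.Build (H0_dist M) (H0_dist N)
  H0_fun H0_fun_additive.
HB.instance Definition _ := GRing.isScalable.Build A (H0_dist M) (H0_dist N) *:%R
  H0_fun H0_fun_scalable.
Fact H0_fun_comp i x : H0_fun (comp (gm_gr (H0_dist M)) i x) =
  comp (gm_gr (H0_dist N)) i (H0_fun x).
Proof. by apply: val_inj; rewrite /= gh_comp. Qed.
Definition H0_map : grhom (H0_dist M) (H0_dist N) := @GrHom k A _ _ H0_fun H0_fun_comp.
End Map.

(* H^0_dist followed by the forgetful functor to abelian groups.  The latter is
   exact, so the derived functors of the composite are the underlying abelian
   groups of the H^n_dist. *)
Definition H0_obj (M : grmod A) : zmodType := H0_dist M.
Definition H0_mor (M N : grmod A) (g : grhom M N) :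
  {additive H0_obj M -> H0_obj N} := H0_map g.
Fact H0_mor_id M : H0_mor (grhom_id M) =1 id.
Proof. by move=> x; apply: val_inj. Qed.
Fact H0_mor_comp X Y M (g : grhom Y M) (f : grhom X Y) :
  H0_mor (grhom_comp g f) =1 H0_mor g \o H0_mor f.
Proof. by move=> x; apply: val_inj. Qed.
Definition H0_functor : abfunctor A := AbFunctor H0_mor_id H0_mor_comp.

Definition H_dist (n : int) (M : grmod A) (J : injres M) : zmodType :=
  derived H0_functor n J.
Definition H_dist_map (n : int) (M N : grmod A) (f : grhom M N) (J : injres M)
    (K : injres N) (phi : resmap f J K) : H_dist n J -> H_dist n K :=
  derived_map (F := H0_functor) phi.

(* A natural isomorphism from H^n_dist to colim_j Ext^n(A/I_j, -).  A functor
   computed by injective resolutions has one value for each resolution [J] of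
   [M]; these are canonically isomorphic through the maps of resolutions lifting
   the identity.  Naturality for all maps of resolutions contains both the
   compatibility with these identifications and the naturality in [M]. *)
Definition dist_colim_iso (n : int)
    (phi : forall (M : grmod A) (J : injres M), {additive H_dist n J -> colim_Ext n J}) :
    Prop :=
  (forall M J, bijective (phi M J)) /\
  forall (M N : grmod A) (f : grhom M N) (J : injres M) (K : injres N)
    (F : resmap f J K) x,
    phi N K (H_dist_map F x) = colim_Ext_map F (phi M J x).
End Distinguished.

(* Main.v *)
(* Since the dual basis of a finite-type C recovers the coaction from the action
   of A, the dual of C, graded comodules are the graded A-modules each of whose
   elements is killed by all homogeneous elements of large degree.  Let P be
   projective and let x in P be homogeneous of degree d, killed by the elements
   of degree >= j.  Cover P by a direct sum of truncations A/A_{>= J(y)}, one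
   generator for each homogeneous y in P; the bounds J(y) may be as large as we
   like.  A section of the cover sends x to an element whose coordinate at y is
   represented by some a in A of degree d - |y|.  The finite-dimensional space
   A_{d - |y|} lies in one Poincare subalgebra A(m) of top degree
   n >= j + d - |y|, so if a <> 0 then the pairing gives b of degree
   n - (d - |y|) >= j with b a <> 0 in degree n; taking J(y) > n, this remains
   nonzero in the truncation although b kills x.  Hence x = 0. *)
From HB Require Import structures.
From mathcomp.multinomials Require Import freeg.
From mathcomp Require Import all_boot all_order all_algebra.
From mathcomp Require Import boolp.
From mathcomp Require Import zify.
Require Import Defs.

Set Implicit Arguments.
Unset Strict Implicit.
Unset Printing Implicit Defensive.

Import Order.TTheory GRing.Theory Num.Theory.
Local Open Scope ring_scope.

(** * Coordinates on a finite-dimensional graded piece *)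

(** A homogeneous spanning family of least size is linearly independent, so coordinates in it are
    unique and therefore linear. *)
Lemma fin_dim_dual_basis (k : fieldType) (V : gvect k) (n : int) :
  fin_dim (homog (gv_gr V) n) ->
  exists p (b : 'I_p -> V) (f : 'I_p -> V -> k^o),
    [/\ forall i, homog (gv_gr V) n (b i), forall i, linear (f i),
        forall i x, f i (comp (gv_gr V) n x) = f i x
      & forall x, comp (gv_gr V) n x = \sum_i (f i x : k) *: b i].
Proof.
pose spans p (b : 'I_p -> V) := (forall i, homog (gv_gr V) n (b i)) /\
  forall x, exists c : 'I_p -> k, comp (gv_gr V) n x = \sum_i c i *: b i.
move=> [p0 [b0 b0P]]; have ex : exists p, `[< exists b, @spans p b >].
  exists p0; apply/asboolP; exists (fun i => comp (gv_gr V) n (b0 i)).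
  split=> [i|x]; first exact: homog_comp.
  have [c cE] := b0P _ (homog_comp (gv_gr V) n x); exists c.
  rewrite -[LHS](homog_comp (gv_gr V) n x) {1}cE raddf_sum.
  by apply: eq_bigr => i _; rewrite gv_scale.
have [p /asboolP[b [bn bS]] pmin] := ex_minnP ex.
have free (c : 'I_p -> k) : \sum_i c i *: b i = 0 -> forall i, c i = 0.
  move=> c0 i; apply/eqP/negPn/negP => ci.
  have {ex}: spans p b by [].
  case: p b bn bS pmin c c0 i ci => [|p] b bn bS pmin c c0 i ci _; first by case: i ci.
  suff /pmin : `[< exists b, @spans p b >] by rewrite ltnn.
  apply/asboolP; exists (fun j => b (lift i j)); split=> [j|x]; first exact: bn.
  (* Since [c i] is invertible, the relation [c] expresses [b i] through the other vectors; dropping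
     it contradicts minimality. *)
  have [d dE] := bS x; exists (fun j => d (lift i j) - d i / c i * c (lift i j)).
  rewrite dE; move: c0; rewrite !(bigD1_ord i) //= => c0.
  under [RHS]eq_bigr do rewrite scalerBl -scalerA.
  rewrite sumrB -scaler_sumr; move/eqP: c0; rewrite addrC addr_eq0 => /eqP ->.
  by rewrite scalerN opprK scalerA divfK // addrC.
have [F FE] := choice bS.
have Fu x (c : 'I_p -> k) : comp (gv_gr V) n x = \sum_i c i *: b i -> F x =1 c.
  move=> xE i; apply/eqP; rewrite -subr_eq0; apply/eqP; apply: (free (fun i => F x i - c i)).
  by under eq_bigr do rewrite scalerBl; rewrite sumrB -FE xE subrr.
exists p, b, (fun i x => F x i); split=> // [i a x y|i x].
  apply: (Fu _ (fun j => a * F x j + F y j)); rewrite raddfD gv_scale !FE scaler_sumr -big_split /=.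
  by apply: eq_bigr => j _; rewrite scalerDl scalerA.
by apply: (Fu _ (F x)); rewrite homog_comp FE.
Qed.

(** * Contraction of tensors with functionals *)

Section Evaluation.
Variables (k : fieldType) (C : gcoalg k).
Implicit Types f g : dual C.

(** The map [f \otimes id_V]; on a coaction it gives the action of [f]. *)
Definition teval (V : lmodType k) f (t : tensor C V) : V :=
  tlift (fun c x => (f c : k) *: x) t.

Lemma teval_bilin (V : lmodType k) f : bilin (fun c (x : V) => (f c : k) *: x).
Proof.
split=> [x|c a x y]; first exact/lin_scale/dual_linear.
by rewrite scalerDr !scalerA mulrC.
Qed.

Lemma teval_linear (V : lmodType k) f : linear (@teval V f).
Proof. exact: tlift_linear (teval_bilin V f). Qed.

Lemma teval_tens (V : lmodType k) f c (x : V) : teval f (tens c x) = (f c : k) *: x.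
Proof. exact: tlift_tens (teval_bilin V f) _ _. Qed.

Lemma teval_tmap (V W : lmodType k) (h : V -> W) f t : linear h ->
  teval f (tmap id h t) = h (teval f t).
Proof.
move=> hL; move: t; apply: tensor_ext.
- by apply: lin_comp; [exact: teval_linear | exact: tmap_linear].
- by apply: lin_comp; [exact: hL | exact: teval_linear].
- by move=> c x; rewrite tmap_tens // !teval_tens (scalable_linear hL).
Qed.

(** The product of the dual feeds the first factor of the coproduct to its right argument, so [g]
    contracts first and [f] second. *)
Lemma teval_assoc (V : lmodType k) f g (t : tensor C V) :
  teval f (teval g (tassoc (tmap (gc_delta C) id t))) = teval (f * g) t.
Proof.
have L2 : linear (fun t : tensor C (tensor C V) => teval f (teval g t)).
  exact: lin_comp (teval_linear f) (teval_linear g).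
have dL : linear (gc_delta C) by exact: linearP.
have fgB := dmul_bilin (dual_linear f) (dual_linear g).
move: t; apply: tensor_ext; last move=> c x.
- apply: (@lin_comp _ _ _ _ (fun t : tensor C (tensor C V) => teval f (teval g t))) => //.
  apply: (@lin_comp _ _ _ _ (@tassoc k C C V)); first exact: tassoc_linear.
  exact: tmap_linear.
- exact: teval_linear.
rewrite tmap_tens // teval_tens /= /dmul; move: (gc_delta C c) => s; move: s.
apply: tensor_ext => [||a b].
- apply: (@lin_comp _ _ _ _ (fun t : tensor C (tensor C V) => teval f (teval g t))) => //.
  apply: (@lin_comp _ _ _ _ (@tassoc k C C V)); first exact: tassoc_linear.
  exact: tens_linl.
- by apply: lin_scale; exact: tlift_linear.
- rewrite tassoc_tens !teval_tens (scalable_linear (teval_linear f)) teval_tens.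
  by rewrite (tlift_tens fgB) [LHS]scalerA.
Qed.

Lemma teval_psi (M : grcomod C) f (m : iota_car M) :
  teval f (cm_psi M m) = f *: m.
Proof. by []. Qed.

End Evaluation.

(** * Finiteness of homogeneous decompositions *)

Section Grading.
Variables (V : zmodType) (G : grading V).

Lemma comp_sum_seq (t : seq int) (x : V) : uniq t ->
  (forall i, i \notin t -> comp G i x = 0) -> x = \sum_(i <- t) comp G i x.
Proof.
move=> ut xt; have [s us xE] := comp_sum G x.
have xs i : i \notin s -> comp G i x = 0.
  move=> si; rewrite xE raddf_sum /= big_seq big1 // => j js.
  by rewrite comp_comp; case: eqP => // ij; rewrite ij js in si.
(* Both sums reduce to the indices lying in [s] and in [t]. *)
rewrite {1}xE (bigID (mem t)) /= [X in _ + X]big1 => [|i /xt //].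
rewrite [RHS](bigID (mem s)) /= [X in _ = _ + X]big1 => [|i /xs //].
rewrite !addr0 -[LHS]big_filter -[RHS]big_filter; apply: perm_big.
by apply: uniq_perm => [||i]; rewrite ?filter_uniq // !mem_filter andbC.
Qed.

Lemma comp_eq0 x : (forall i, comp G i x = 0) -> x = 0.
Proof.
by move=> x0; rewrite [LHS](@comp_sum_seq [::]) ?big_nil.
Qed.

Lemma comp_bound x : exists N : nat, forall i, (N <= `|i|)%N -> comp G i x = 0.
Proof.
have [s _ xE] := comp_sum G x; exists (\sum_(i <- s) `|i|).+1 => i Ni.
rewrite xE raddf_sum /= big_seq big1 // => j js.
rewrite comp_comp; case: eqP => // ij; move: Ni.
by rewrite (big_rem j) //= ij ltnNge leq_addr.
Qed.

Lemma comp_sum_nonneg x : (forall i : int, i < 0 -> comp G i x = 0) ->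
  exists N : nat, forall N', (N <= N')%N -> x = \sum_(n < N') comp G n x.
Proof.
move=> x0; have [N NP] := comp_bound x; exists N => N' NN'.
rewrite [LHS](@comp_sum_seq [seq n%:Z | n <- iota 0 N']).
- by rewrite big_map -[X in iota 0 X]subn0 big_mkord.
- by rewrite map_inj_uniq ?iota_uniq // => i j [].
- move=> [i|i]; last by rewrite x0.
  rewrite mem_map; last by move=> ? ? [].
  by rewrite mem_iota add0n /= -leqNgt => /(leq_trans NN') Ni; apply: NP.
Qed.

End Grading.

(** * Homogeneous components of an action; torsion modules *)

Section Algebra.
Variables (k : fieldType) (A : galg k).

Lemma comp_act_homog (M : grmod A) n d a (x : M) : homog (gm_gr M) d x ->
  comp (gm_gr M) n (a *: x) = comp (ga_gr A) (n - d) a *: x.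
Proof.
move=> xd; have [s us aE] := comp_sum (ga_gr A) a.
rewrite (comp_act n x us aE).
under eq_bigr => i _ do rewrite (comp_homog _ xd).
rewrite {2}aE raddf_sum scaler_suml; apply: eq_bigr => i _ /=.
rewrite comp_comp subr_eq addrC -subr_eq.
by rewrite eq_sym; case: eqP => // _; rewrite ?scaler0 ?scale0r.
Qed.

Lemma comp_homog_act (M : grmod A) n d a (x : M) : homog (ga_gr A) d a ->
  comp (gm_gr M) n (a *: x) = a *: comp (gm_gr M) (n - d) x.
Proof.
move=> ad; rewrite (@comp_act _ _ _ n a [:: d]) ?big_seq1 ?ad //.
Qed.

Lemma scalar_act_comp (M : grmod A) n (c : k) (x : M) :
  comp (gm_gr M) n (c%:A *: x) = c%:A *: comp (gm_gr M) n x.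
Proof.
have h : homog (ga_gr A) 0 (c%:A) by rewrite /homog ga_scale ga_one.
by rewrite (comp_homog_act _ _ h) subr0.
Qed.

(** The property that singles out modules coming from comodules; the bound may vary with the
    element. *)
Definition torsion (M : grmod A) : Prop := forall x : M, exists N : nat,
  forall (n : int) a, N%:Z <= n -> homog (ga_gr A) n a -> a *: x = 0.

End Algebra.

(** * Expansion in dual bases *)

Section Expansion.
Variables (k : fieldType) (C : gcoalg k).

(** A member of [B n] pairs a vector of degree [-n] with its coordinate functional of degree [n];
    natural [n] cover a coalgebra in nonpositive degrees. *)
Definition dual_bases (B : nat -> seq (C * dual C)) : Prop := forall n : nat,
  (forall q, q \in B n -> homog (gv_gr C) (- n%:Z) q.1 /\ homog (dual_grading C) n q.2)
  /\ forall x, comp (gv_gr C) (- n%:Z) x = \sum_(q <- B n) (q.2 x : k) *: q.1.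

Lemma dual_bases_exist : finite_type C -> exists B, dual_bases B.
Proof.
move=> ft; suff H (n : nat) : exists s : seq (C * dual C),
    (forall q, q \in s -> homog (gv_gr C) (- n%:Z) q.1 /\ homog (dual_grading C) n q.2)
    /\ forall x, comp (gv_gr C) (- n%:Z) x = \sum_(q <- s) (q.2 x : k) *: q.1.
  by have [B BP] := choice H; exists B.
have [p [b [f [bn fL fn fE]]]] := fin_dim_dual_basis (ft (- n%:Z)).
have fP i : f i \in @dual_pred k C.
  apply/asboolP; split=> //; exists [:: - n%:Z] => j; rewrite inE => jn c.
  rewrite -fn comp_comp eq_sym (negbTE jn).
  by apply: (addIr (f i 0)); have := fL i 1 0 0; rewrite !scale1r !add0r.
exists [seq (b i, Dual (fP i)) | i <- index_enum 'I_p]; split=> [q /mapP[i _ ->]|x].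
  by split; [exact: bn | rewrite /homog; apply: dual_eq => c; exact: fn].
by rewrite big_map fE.
Qed.

Variable B : nat -> seq (C * dual C).
Hypothesis BP : dual_bases B.
Hypothesis C_nonpos : forall (n : int) x, 0 < n -> homog (gv_gr C) n x -> x = 0.

Lemma coalg_sum (c : C) : exists N : nat, forall N', (N <= N')%N ->
  c = \sum_(n < N') \sum_(q <- B n) (q.2 c : k) *: q.1.
Proof.
have [N NP] := comp_bound (gv_gr C) c; exists N => N' NN'.
rewrite [LHS](@comp_sum_seq _ (gv_gr C) [seq - n%:Z | n <- iota 0 N']).
- rewrite big_map -[X in iota 0 X]subn0 big_mkord.
  by apply: eq_bigr => n _; rewrite (BP n).2.
- by rewrite map_inj_uniq ?iota_uniq // => i j /oppr_inj [].
- move=> i; have [i0 _|] := ltP 0 i; first exact: C_nonpos i0 (homog_comp _ _ _).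
  move=> i0; have -> : i = - (`|i|%N)%:Z by lia.
  rewrite (mem_map (f := fun n : nat => - n%:Z)); last by move=> ? ? /oppr_inj [].
  by rewrite mem_iota add0n /= -leqNgt => /(leq_trans NN') ?; apply: NP; rewrite abszN.
Qed.

(** Every larger cut-off [N'] is allowed so that two tensors can be expanded over a common range. *)
Lemma tensor_sum (V : lmodType k) (t : tensor C V) : exists N : nat, forall N',
  (N <= N')%N -> t = \sum_(n < N') \sum_(q <- B n) tens q.1 (teval q.2 t).
Proof.
have lin0 (U W : lmodType k) (h : U -> W) : linear h -> h 0 = 0.
  by move=> hL; apply: (addIr (h 0)); have := hL 1 0 0; rewrite !scale1r !add0r.
have linD (U W : lmodType k) (h : U -> W) : linear h -> {morph h : x y / x + y}.
  by move=> hL x y; have := hL 1 x y; rewrite !scale1r.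
move: t; apply: tensor_ind => [|c x|t u [N Nt] [N' Nu]].
- exists 0%N => N' _; rewrite big1 // => n _; rewrite big1 // => q _.
  by rewrite (lin0 _ _ _ (teval_linear _)) (lin0 _ _ _ (tens_linr _)).
- have [N NP] := coalg_sum c; exists N => N' /NP {1}->.
  rewrite (big_morph _ (linD _ _ _ (tens_linl x)) (lin0 _ _ _ (tens_linl x))).
  apply: eq_bigr => n _.
  rewrite (big_morph _ (linD _ _ _ (tens_linl x)) (lin0 _ _ _ (tens_linl x))).
  apply: eq_bigr => q _; rewrite teval_tens.
  by rewrite (scalable_linear (tens_linl x)) (scalable_linear (tens_linr q.1)).
- exists (maxn N N') => m; rewrite geq_max => /andP[/Nt {1}-> /Nu {1}->].
  rewrite -big_split; apply: eq_bigr => n _; rewrite -big_split.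
  apply: eq_bigr => q _ /=.
  by rewrite (linD _ _ _ (teval_linear _)) (linD _ _ _ (tens_linr _)).
Qed.

(** By [tensor_sum] a tensor is determined by its contractions. Identities between coactions thereby
    become identities between actions. *)
Lemma teval_ext (V : lmodType k) (t u : tensor C V) :
  (forall f : dual C, teval f t = teval f u) -> t = u.
Proof.
move=> tu; have [N Nt] := tensor_sum t; have [N' Nu] := tensor_sum u.
rewrite [LHS](Nt (maxn N N')) ?leq_maxl // [RHS](Nu (maxn N N')) ?leq_maxr //.
by apply: eq_bigr => n _; apply: eq_bigr => q _; rewrite tu.
Qed.

End Expansion.

(** * The comodule structure on a torsion module *)

Section ComoduleOfTorsion.
Variables (k : fieldType) (C : gcoalg k) (B : nat -> seq (C * dual C)).
Hypothesis BP : dual_bases B.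
Hypothesis C_nonpos : forall (n : int) x, 0 < n -> homog (gv_gr C) n x -> x = 0.

Lemma dual_comp_neg (f : dual C) (n : int) : n < 0 -> comp (dual_grading C) n f = 0.
Proof.
move=> n0; apply: dual_eq => c; rewrite /= -[RHS](dual0 f); congr (f _).
by apply: (C_nonpos _ (homog_comp (gv_gr C) (- n) c)); rewrite oppr_gt0.
Qed.

(** Apply [g] to the expansion of a vector of degree [-n]. *)
Lemma dual_comp_bases (g : dual C) (n : nat) :
  comp (dual_grading C) n g = \sum_(q <- B n) (g q.1 : k) *: q.2.
Proof.
apply: dual_eq => c; rewrite dual_sum /= (BP n).2 dual_sumr.
apply: eq_bigr => q _; rewrite (scalable_linear (dual_linear g)).
exact: mulrC.
Qed.

Variables (M : grmod (dual_galg C)) (M_torsion : torsion M).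

(** Restriction of scalars along [k -> A], since coactions are [k]-linear. *)
Definition restr : Type := gm_car M.
HB.instance Definition _ := GRing.Zmodule.on restr.
Definition restr_scale (c : k) (x : restr) : restr := (c%:A : dual_galg C) *: (x : M).
Fact restr_scaleA a b x : restr_scale a (restr_scale b x) = restr_scale (a * b) x.
Proof. by rewrite /restr_scale scalerA -scalerAl mul1r scalerA. Qed.
Fact restr_scale1 : left_id 1 restr_scale.
Proof. by move=> x; rewrite /restr_scale !scale1r. Qed.
Fact restr_scaleDr : right_distributive restr_scale +%R.
Proof. by move=> c x y; apply: scalerDr. Qed.
Fact restr_scaleDl x : {morph restr_scale^~ x : a b / a + b}.
Proof. by move=> a b; rewrite /restr_scale scalerDl [LHS]scalerDl. Qed.
HB.instance Definition _ := GRing.Zmodule_isLmodule.Build k restr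
  restr_scaleA restr_scale1 restr_scaleDr restr_scaleDl.

Definition restr_gvect : gvect k :=
  @GVect k restr (gm_gr M : grading restr) (@scalar_act_comp _ _ M).

Lemma restr_scaleE (c : k) (f : dual C) (x : M) :
  c *: (f *: x : restr) = (c *: f) *: x.
Proof. by rewrite [LHS]scalerA -scalerAl mul1r. Qed.

Lemma act_restr_linear (f : dual C) : linear (fun x : restr => f *: (x : M) : restr).
Proof.
move=> c x y; rewrite scalerDr; congr (_ + _).
by rewrite restr_scaleE [LHS]scalerA -scalerAr mulr1.
Qed.

(** The coaction is the sum of [e \otimes e^* x] over dual bases, cut where the [e^*] start to kill
    [x]. The cut is an arbitrary choice for each [x], but the contractions computed next do not
    depend on it. *)
Definition torsion_psi (x : restr_gvect) : tensor C restr_gvect :=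
  \sum_(n < sval (cid (M_torsion x))) \sum_(q <- B n)
    tens q.1 (q.2 *: (x : M) : restr_gvect).

Lemma teval_torsion_psi (g : dual C) (x : restr_gvect) :
  teval g (torsion_psi x) = g *: (x : M).
Proof.
rewrite /torsion_psi; case: cid => N /= NP.
have gD (t u : tensor C restr_gvect) : teval g (t + u) = teval g t + teval g u.
  by have := teval_linear g 1 t u; rewrite !scale1r.
have g0 : teval g (0 : tensor C restr_gvect) = 0.
  by apply: (addIr (teval g (0 : tensor C restr_gvect))); rewrite -gD !add0r.
have [K gE] := comp_sum_nonneg (dual_comp_neg g).
(* The cut at [N + K] serves two bounds: beyond [K] the components of [g] vanish, and from degree
   [N] on they kill [x]. *)
rewrite (big_morph _ gD g0) [g in RHS](gE (N + K)%N) ?leq_addl //.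
rewrite scaler_suml big_split_ord /= [X in _ = _ + X]big1 => [|i _]; last first.
  by apply: NP (homog_comp _ _ _); rewrite lez_nat leq_addr.
rewrite addr0; apply: eq_bigr => n _; rewrite (big_morph _ gD g0).
rewrite [in RHS]dual_comp_bases scaler_suml; apply: eq_bigr => q _.
by rewrite teval_tens restr_scaleE.
Qed.

Fact torsion_psi_linear : linear torsion_psi.
Proof.
move=> c x y; apply: (teval_ext BP C_nonpos) => f.
by rewrite (teval_linear f) !teval_torsion_psi act_restr_linear.
Qed.
HB.instance Definition _ := GRing.isLinear.Build k restr_gvect
  (tensor C restr_gvect) *:%R torsion_psi torsion_psi_linear.

(** After two contractions this is [(f * g) x = f (g x)]. *)
Fact torsion_coassoc x : tassoc (tmap (gc_delta C) id (torsion_psi x)) =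
  tmap id torsion_psi (torsion_psi x).
Proof.
do 2 apply: (teval_ext BP C_nonpos) => ?.
rewrite teval_assoc (teval_tmap _ _ torsion_psi_linear) !teval_torsion_psi.
by rewrite scalerA.
Qed.

Fact torsion_counit x : tlift (fun c y => gc_eps C c *: y) (torsion_psi x) = x.
Proof. by rewrite [LHS](teval_torsion_psi (dual_one C)) scale1r. Qed.

Fact torsion_psi_homog n x : homog (gv_gr restr_gvect) n x ->
  torsion_psi x \in @tensor_homog k C restr_gvect n.
Proof.
move=> xn; apply: rpred_sum => i _; rewrite big_seq; apply: rpred_sum => q qB.
have [q1 q2] := (BP i).1 _ qB; apply: mem_gen_submod.
by exists (- (i : nat)%:Z), ((i : nat)%:Z + n), q.1, (q.2 *: (x : M)); split=> //; [rewrite addKr | exact: gm_act].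
Qed.

Definition torsion_comod : grcomod C :=
  @GrComod k C restr_gvect torsion_psi torsion_coassoc torsion_counit torsion_psi_homog.

Section Hom.
Variables (P : grcomod C) (h : grhom M (iota_grmod P)).

Definition torsion_fun (x : torsion_comod) : P := h x.
Fact torsion_fun_linear : linear torsion_fun.
Proof.
move=> c x y; rewrite /torsion_fun [h _]raddfD /= [h _]linearZ /=; congr (_ + _).
(* By the counit axiom the scalar [c] acts on [P] as the functional [c *: 1]. *)
transitivity ((c *: (1 : dual C)) *: (h x : iota_car P)) => //.
rewrite -teval_psi.
have -> (t : tensor C P) : teval (c *: (1 : dual C)) t = c *: teval (1 : dual C) t.
  move: t; apply: tensor_ext; first exact: teval_linear.
    by move=> a t u; rewrite (teval_linear (1 : dual C)) scalerDr !scalerA mulrC.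
  by move=> d y'; rewrite !teval_tens scalerA.
by rewrite teval_psi scale1r.
Qed.
HB.instance Definition _ := GRing.isLinear.Build k torsion_comod P *:%R
  torsion_fun torsion_fun_linear.

Fact torsion_fun_psi x : cm_psi P (torsion_fun x) =
  tmap id torsion_fun (cm_psi torsion_comod x).
Proof.
apply: (teval_ext BP C_nonpos) => f.
rewrite (teval_tmap _ _ torsion_fun_linear) [teval f (cm_psi torsion_comod x)]teval_torsion_psi.
by rewrite teval_psi /torsion_fun linearZ.
Qed.

Definition torsion_hom : comod_hom torsion_comod P :=
  @ComodHom k C torsion_comod P torsion_fun (gh_comp h) torsion_fun_psi.
End Hom.

End ComoduleOfTorsion.

(** * Comodules as torsion modules *)

Lemma comod_hom_act (k : fieldType) (C : gcoalg k) (M N : grcomod C)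
    (g : comod_hom M N) (f : dual C) (x : iota_car M) :
  g (f *: x) = f *: (g x : iota_car N).
Proof.
rewrite -!teval_psi ch_psi teval_tmap //; exact: linearP.
Qed.

(** A tensor involves finitely many elements of [C], and a functional of large degree vanishes on
    all of them. *)
Lemma comod_torsion (k : fieldType) (C : gcoalg k) (P : grcomod C) :
  torsion (iota_grmod P).
Proof.
move=> x; suff H (t : tensor C P) : exists N : nat, forall (n : int) (f : dual C),
    N%:Z <= n -> homog (dual_grading C) n f -> teval f t = 0.
  by have [N NP] := H (cm_psi P x); exists N => n f Nn fn; apply: NP Nn fn.
move: t; apply: tensor_ind => [|c y|t u [N Nt] [N' Nu]].
- exists 0%N => n f _ _; apply: (addIr (teval f 0)).
  by have := teval_linear f 1 (0 : tensor C P) 0; rewrite !scale1r !add0r.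
- have [N NP] := comp_bound (gv_gr C) c; exists N => n f Nn fn.
  rewrite teval_tens -fn /= NP ?dual0 ?scale0r //; lia.
- exists (maxn N N') => n f Nn fn.
  have := teval_linear f 1 t u; rewrite !scale1r => ->.
  by rewrite (Nt n) ?(Nu n) ?addr0 //; lia.
Qed.

(** * Poincaré duality in large subalgebras *)

(** The bound [J] is uniform in [y]: one Poincaré subalgebra contains all of degree [d], and pairing
    into its top degree supplies [a]. *)
Lemma P_algebra_escape (k : fieldType) (A : galg k) : P_algebra A ->
  (forall i, fin_dim (homog (ga_gr A) i)) ->
  (forall N : nat, exists (n : int) z, [/\ N%:Z <= n, homog (ga_gr A) n z & z != 0]) ->
  forall d j : int, exists J : nat, forall y, homog (ga_gr A) d y -> y != 0 ->
    exists (n : int) a,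
      [/\ homog (ga_gr A) n a, j <= n, n + d < J%:Z & a * y != 0].
Proof.
move=> [A_conn [S [homS [incS [_ exhS poinS _]]]]] A_fin A_unb d j.
have mono m m' : (m <= m')%N -> {subset S m <= S m'}.
  elim: m' => [|m' IH]; first by rewrite leqn0 => /eqP ->.
  by rewrite leq_eqVlt => /orP[/eqP <- //|/IH {}IH x /IH /incS].
have [m1 Sd] : exists m, forall y, homog (ga_gr A) d y -> y \in S m.
  have [p [b bP]] := A_fin d; have [mu muP] := choice (fun i => exhS (b i)).
  exists (\max_i mu i) => y /bP[c ->]; apply: rpred_sum => i _; apply: rpredZ.
  exact: mono (leq_bigmax i) _ (muP i).
(* A nonzero [z] of degree at least [|j| + |d|] will force the top degree to be at least [j + d]. *)
have [D [z [DP zD z0]]] := A_unb (`|j| + `|d|)%N.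
have [m2 zS] := exhS z; pose m := maxn m1 m2.
have zm : z \in S m by apply: mono zS; exact: leq_maxr.
have [_ [B_neg _] [n0 [ev [_ pair]]]] := poinS m.
(* Otherwise the degree [n0 - D] complementary to [z] is negative, so [z] pairs to zero with
   everything there. *)
have Dn0 : D <= n0.
  rewrite leNgt; apply/negP => lt_n0D; move/eqP: z0; apply.
  suff /(congr1 val) : Subalg zm = 0 :> sub_galg (homS m) by [].
  apply: (pair D).1 => [|y yn]; first exact/subalg_homog.
  by rewrite (B_neg _ _ _ yn) ?subr_lt0 // mulr0 raddf0.
(* The product [a * y] will lie in the top degree [n0], which must be strictly below [J]. *)
exists `|n0|.+1 => y yd y0.
have ym : y \in S m by apply: mono (Sd y yd); exact: leq_maxl.
have : ~ forall x, homog (ga_gr (sub_galg (homS m))) (n0 - d) x ->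
    ev (x * (Subalg ym : sub_galg (homS m))) = 0.
  move=> /(pair (n0 - d)).2 H; move/eqP: y0; apply.
  by apply: (congr1 val (H _)); apply/subalg_homog; rewrite opprB addrC subrK.
move=> /existsNP[x /not_implyP[xn xy]].
exists (n0 - d), (val x); split; first by move/subalg_homog: xn.
- by rewrite lerBrDr (le_trans _ Dn0) //; lia.
- by rewrite subrK; lia.
- apply/eqP => xy0; apply: xy.
  suff -> : x * (Subalg ym : sub_galg (homS m)) = 0 by rewrite raddf0.
  exact: val_inj.
Qed.

(** * Sums of suspended truncations of the algebra *)

Section TruncatedFree.
Variables (k : fieldType) (A : galg k).
Hypothesis A_nonneg : forall (i : int) x, i < 0 -> homog (ga_gr A) i x -> x = 0.
Variables (X : choiceType) (deg : X -> int) (J : X -> nat).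
Local Notation F := {freeg X / A}.

(** The generator [x] sits in degree [deg x], hence the shift of the coefficient. *)
Definition free_comp i (r : F) : F :=
  \sum_(x <- dom r) << comp (ga_gr A) (i - deg x) (coeff x r) *g x >>.

Lemma coeff_free_comp i y r :
  coeff y (free_comp i r) = comp (ga_gr A) (i - deg y) (coeff y r).
Proof.
rewrite /free_comp raddf_sum /=; have [yr|yr] := boolP (y \in dom r).
  rewrite (bigD1_seq y) ?uniq_dom //= coeffU eqxx mulr1 big1 ?addr0 // => x xy.
  by rewrite coeffU (negbTE xy) mulr0.
rewrite (coeff_outdom yr) raddf0 big_seq big1 // => x xr.
by rewrite coeffU; case: eqP xr => [->|]; rewrite ?(negbTE yr) // mulr0.
Qed.

Fact free_comp_additive i : zmod_morphism (free_comp i).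
Proof.
by move=> r s; apply/eqP/freeg_eqP => y; rewrite coeffB !coeff_free_comp coeffB raddfB.
Qed.
HB.instance Definition _ i := GRing.isZmodMorphism.Build F F (free_comp i)
  (free_comp_additive i).

Fact free_comp_comp i j r :
  free_comp i (free_comp j r) = if i == j then free_comp j r else 0.
Proof.
apply/eqP/freeg_eqP => y; rewrite !coeff_free_comp comp_comp (inj_eq (addIr _)).
by case: eqP => _; rewrite ?coeff_free_comp ?coeff0.
Qed.

Fact free_comp_sum r : exists2 s : seq int, uniq s & r = \sum_(i <- s) free_comp i r.
Proof.
have [N NP] := choice (fun x => comp_bound (ga_gr A) (coeff x r)).
(* All nonzero components of [r] lie in degrees between [-K] and [K]; the list [s] is this
   interval. *)
pose K := (\sum_(x <- dom r) (N x + `|deg x|))%N.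
have [s [us sP]] : exists s : seq int, uniq s /\
    forall i : int, (`|i| <= K)%N -> i \in s.
  exists [seq n%:Z - K%:Z | n <- iota 0 K.*2.+1]; split=> [|i iK].
    by rewrite map_inj_uniq ?iota_uniq // => m n /addIr [].
  apply/mapP; exists `|(i + K%:Z)%R|%N; last lia.
  by rewrite mem_iota; lia.
exists s => //.
apply/eqP/freeg_eqP => y; rewrite raddf_sum /=.
under eq_bigr do rewrite coeff_free_comp.
rewrite -(big_map (fun i => i - deg y) xpredT (fun i => comp _ i _)).
apply: comp_sum_seq => [|i].
  by rewrite map_inj_uniq //; exact: addIr.
have [yr|/coeff_outdom -> _] := boolP (y \in dom r); last by rewrite raddf0.
move=> iy; apply: NP; rewrite leqNgt; apply: contra iy => iN.
have KP : (N y + `|deg y| <= K)%N by rewrite /K (big_rem y) //= leq_addr.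
by apply/mapP; exists (i + deg y); [apply: sP; lia | rewrite addrK].
Qed.

Definition free_grading : grading F := Grading free_comp_comp free_comp_sum.

Lemma free_homog i r : homog free_grading i r <->
  forall x, homog (ga_gr A) (i - deg x) (coeff x r).
Proof.
split=> [ri x|ri]; first by rewrite -ri coeff_free_comp; exact: homog_comp.
by apply/eqP/freeg_eqP => x; rewrite /= coeff_free_comp; exact: ri.
Qed.

Fact free_act i j a r : homog (ga_gr A) i a -> homog free_grading j r ->
  homog free_grading (i + j) (a *: r).
Proof.
move=> ai /free_homog rj; apply/free_homog => x.
by rewrite coeffZ -addrA; apply: ga_mul.
Qed.
Definition free_grmod : grmod A := @GrMod k A F free_grading free_act.

(** The bound [J x] is on the degree of the coefficient, before the shift by [deg x]. Left
    multiplication preserves it because [A] has no negative degrees. *)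
Definition trunc_pred : {pred free_grmod} := fun r =>
  `[< forall x (i : int), i < (J x)%:Z -> comp (ga_gr A) i (coeff x (r : F)) = 0 >].

Fact trunc_closed : submod_closed trunc_pred.
Proof.
split=> [|a u v /asboolP uJ /asboolP vJ]; apply/asboolP => x i iJ.
  by rewrite coeff0 raddf0.
rewrite coeffD coeffZ raddfD /= vJ // addr0.
have [s us aE] := comp_sum (ga_gr A) a.
rewrite [LHS](@comp_act _ _ (reg_grmod A) i a s _ us aE) big1 // => p _.
have [p0|p0] := ltP p 0; first by rewrite (A_nonneg p0 (homog_comp _ _ _)) scale0r.
by rewrite [X in _ *: X]uJ ?scaler0 //; lia.
Qed.
HB.instance Definition _ := GRing.isSubmodClosed.Build A free_grmod trunc_pred
  trunc_closed.

Fact trunc_comp i r : r \in trunc_pred -> comp (gm_gr free_grmod) i r \in trunc_pred.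
Proof.
move=> /asboolP rJ; apply/asboolP => x j jJ; rewrite /= coeff_free_comp comp_comp.
by case: eqP => // <-; exact: rJ.
Qed.

(* The direct sum over [x : X] of the suspensions by [deg x] of the quotients
   of [A] by its elements of degree [>= J x]. *)
Definition trunc_grmod : grmod A := quo_grmod trunc_comp.

Lemma trunc_comp_pi i (r : free_grmod) : comp (gm_gr trunc_grmod) i (quot_pi _ r) =
  quot_pi trunc_pred (free_comp i r).
Proof. exact: (quo_compE trunc_comp). Qed.

Lemma trunc_torsion : torsion trunc_grmod.
Proof.
move=> q; rewrite -[q]quot_reprK; set r := quot_repr q.
(* The support of [r] is finite, and the sum of its bounds dominates each of them. *)
exists (\sum_(x <- dom (r : F)) J x)%N => n a Nn an.
rewrite -linearZ -(raddf0 (quot_pi _)); apply/quot_piP; rewrite subr0.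
apply/asboolP => x i iJ; rewrite coeffZ.
rewrite [LHS](@comp_homog_act _ _ (reg_grmod A) i n a _ an).
have [xr|/coeff_outdom ->] := boolP (x \in dom (r : F)); last by rewrite raddf0 scaler0.
have JN : (J x <= \sum_(x <- dom (r : F)) J x)%N by rewrite (big_rem x) //= leq_addr.
rewrite [comp _ _ _](_ : _ = 0) ?scaler0 //.
by apply: (A_nonneg _ (homog_comp _ _ _)); lia.
Qed.

Section Lift.
Variables (P : grmod A) (gen : X -> P).
Hypothesis gen_deg : forall x, homog (gm_gr P) (deg x) (gen x).
Hypothesis gen_tor : forall x (n : int) a, (J x)%:Z <= n ->
  homog (ga_gr A) n a -> a *: gen x = 0.

Definition trunc_lift (q : trunc_grmod) : P := fglift gen (quot_repr q).

(** The choice of representative is harmless: two of them differ at [x] by a coefficient in degrees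
    at least [J x], which kills [gen x]. *)
Lemma trunc_lift_pi (r : free_grmod) :
  trunc_lift (quot_pi _ r) = fglift gen (r : F).
Proof.
apply/eqP; rewrite -subr_eq0 -raddfB /= fgliftE; apply/eqP.
have /asboolP rJ := quot_pi_repr trunc_pred r.
rewrite big1 // => x _.
have [s _ cE] := comp_sum (ga_gr A) (coeff x (quot_repr (quot_pi trunc_pred r) - r : F)).
rewrite cE scaler_suml big1 // => i _; have [iJ|iJ] := ltP i (J x)%:Z.
  by rewrite rJ // scale0r.
exact: gen_tor iJ (homog_comp _ _ _).
Qed.

Fact trunc_lift_additive : zmod_morphism trunc_lift.
Proof.
move=> p q; rewrite -[p]quot_reprK -[q]quot_reprK -raddfB !trunc_lift_pi.
exact: raddfB.
Qed.
Fact trunc_lift_scalable : scalable trunc_lift.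
Proof.
move=> c q; rewrite -[q]quot_reprK -linearZ !trunc_lift_pi.
exact: fglift_scalable.
Qed.
HB.instance Definition _ := GRing.isZmodMorphism.Build trunc_grmod P
  trunc_lift trunc_lift_additive.
HB.instance Definition _ := GRing.isScalable.Build A trunc_grmod P *:%R
  trunc_lift trunc_lift_scalable.

Fact trunc_lift_comp i q :
  trunc_lift (comp (gm_gr trunc_grmod) i q) = comp (gm_gr P) i (trunc_lift q).
Proof.
rewrite -[q]quot_reprK /= (quo_compE trunc_comp) !trunc_lift_pi.
move: (quot_repr q) => r; rewrite /= /free_comp raddf_sum [in RHS]fgliftE raddf_sum.
by apply: eq_bigr => x _ /=; rewrite liftU (comp_act_homog _ _ (gen_deg x)).
Qed.

Definition trunc_hom : grhom trunc_grmod P := @GrHom k A _ _ trunc_lift trunc_lift_comp.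

Lemma trunc_hom_gen x : trunc_hom (quot_pi _ (<< x >> : F)) = gen x.
Proof. by rewrite /= trunc_lift_pi liftU scale1r. Qed.
End Lift.
End TruncatedFree.

(** * Size of the dual algebra *)

Section ProjectiveComodules.
Variables (k : fieldType) (C : gcoalg k).
Local Notation A := (dual_galg C).

Lemma dual_fin_dim (B : nat -> seq (C * dual C)) :
  dual_bases B -> (forall (n : int) x, 0 < n -> homog (gv_gr C) n x -> x = 0) ->
  forall i, fin_dim (homog (ga_gr A) i).
Proof.
move=> BP C_nonpos [n|n]; last first.
  exists 0%N, (fun=> 0) => f fn; exists (fun=> 0); rewrite big_ord0.
  by rewrite -fn; exact: dual_comp_neg C_nonpos _ _ _.
exists (size (B n)), (fun i => (nth 0 (B n) i).2) => f fn.
exists (fun i => f (nth 0 (B n) i).1).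
by rewrite -{1}fn [LHS](dual_comp_bases BP) (big_nth 0) big_mkord.
Qed.

(** If the dual vanished from degree [N] on, so would the coordinate functionals there, and [C]
    would vanish below [-N]. *)
Lemma dual_unbounded (B : nat -> seq (C * dual C)) :
  dual_bases B -> ~ bounded_below (gv_gr C) ->
  forall N : nat, exists (n : int) f,
    [/\ N%:Z <= n, homog (ga_gr A) n f & f != 0].
Proof.
move=> BP C_unb N; apply: contrapT => fN; apply: C_unb; exists (- N%:Z) => i x iN xi.
have {}iE : i = - (`|i|%N)%:Z by lia.
rewrite -xi iE (BP `|i|%N).2 big_seq big1 // => q qB.
suff -> : q.2 = 0 by rewrite scale0r.
apply/eqP/negPn/negP => q0; apply: fN; exists `|i|%N, q.2; split=> //; first lia.
exact: ((BP _).1 _ qB).2.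
Qed.

Fact comod_id_psi (P : grcomod C) (x : P) : cm_psi P x = tmap id id (cm_psi P x).
Proof.
move: (cm_psi P x); apply: tensor_ext => // [|c y]; first exact: tmap_linear.
by rewrite tmap_tens.
Qed.
Definition comod_id (P : grcomod C) : comod_hom P P :=
  @ComodHom k C P P idfun (fun _ _ => erefl) (@comod_id_psi P).

End ProjectiveComodules.

(** * Vanishing of projective comodules *)

Theorem theorem5p3 (k : fieldType) (C : gcoalg k)
  (finite_type_C : finite_type C)
  (connected_C : connected_coalg C)
  (not_bounded_below_C : ~ bounded_below (gv_gr C))
  (P_algebra_dual : P_algebra (dual_galg C))
  (dist_is_colim : forall n : int,
     exists phi : forall (M : grmod (dual_galg C)) (J : injres M),
         {additive H_dist n J -> colim_Ext n J},
       dist_colim_iso phi) :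
  forall P : grcomod C, comod_projective P -> forall x : P, x = 0.
Proof.
have [C_nonpos _] := connected_C; have A_nonneg := P_algebra_dual.1.1.
have [B BP] := dual_bases_exist finite_type_C.
have escape := P_algebra_escape P_algebra_dual (dual_fin_dim BP C_nonpos)
  (dual_unbounded BP not_bounded_below_C).
move=> P P_proj x; apply: (@comp_eq0 _ (gv_gr P)) => d; set xd := comp _ d x.
have [j xj] := comod_torsion (xd : iota_grmod P).
(* Indexing by pairs makes every homogeneous component of every element of [P] a generator, so the
   cover is onto. *)
pose gen (y : P * int) : iota_grmod P := comp (gv_gr P) y.2 y.1.
have gen_deg y : homog (gm_gr (iota_grmod P)) y.2 (gen y) by exact: homog_comp.
(* Two demands on [J]: elements of degree at least [J] kill the generator, so the cover is defined,
   and the products given by [escape] survive truncation. *)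
have /choice[J JP] : forall y : P * int, exists J : nat,
    (forall (n : int) a, J%:Z <= n -> homog (ga_gr (dual_galg C)) n a -> a *: gen y = 0) /\
    forall z, homog (ga_gr (dual_galg C)) (d - y.2) z -> z != 0 ->
      exists (n : int) a, [/\ homog (ga_gr (dual_galg C)) n a, j%:Z <= n,
        n + (d - y.2) < J%:Z & a * z != 0].
  move=> y; have [J1 J1P] := comod_torsion (gen y).
  have [J2 J2P] := escape (d - y.2) j; exists (maxn J1 J2); split=> [n a nJ an|z zd z0].
    by apply: (J1P n) => //; lia.
  have [n [a [an jn nJ az]]] := J2P z zd z0; exists n, a; split=> //; lia.
pose M := trunc_grmod A_nonneg snd J.
have M_tor : torsion M by exact: trunc_torsion.
pose h : grhom M (iota_grmod P) := trunc_hom A_nonneg gen_deg (fun y => (JP y).1).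
pose p := torsion_hom BP C_nonpos M_tor h.
have p_surj y : exists m, p m = y.
  have [s _ yE] := comp_sum (gv_gr P) y.
  exists (\sum_(i <- s) quot_pi _ (<< (y, i) >> : {freeg (P * int) / dual_galg C}) : M).
  rewrite [RHS]yE /= /torsion_fun raddf_sum; apply: eq_bigr => i _.
  exact: (trunc_hom_gen A_nonneg gen_deg (fun y => (JP y).1) (y, i)).
have p_epi : comod_epi p by move=> Z u v uv y; have [m <-] := p_surj y.
(* Lifting the identity of [P] gives a section of the cover; it is injective, so it suffices that it
   kills [xd]. *)
have [g gP] := P_proj _ _ p p_epi (comod_id P).
rewrite -[LHS]gP; suff -> : g xd = 0 by rewrite raddf0.
have gd : comp (gm_gr M) d (g xd) = g xd by rewrite -[LHS](ch_comp g) [comp _ d xd]homog_comp.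
(* The section commutes with the action, so whatever kills [xd] kills its image. *)
have gj (n : int) a : j%:Z <= n -> homog (ga_gr (dual_galg C)) n a ->
    a *: (g xd : M) = 0.
  move=> jn an; rewrite -[LHS](teval_torsion_psi BP C_nonpos M_tor).
  transitivity (g (a *: (xd : iota_car P))); first by rewrite comod_hom_act.
  by rewrite (xj n) // raddf0.
move: gd gj; move: (g xd : M) => q qd qj.
(* A representative homogeneous of degree [d] has homogeneous coefficients, to which the choice of
   [J] applies. *)
pose r : free_grmod (dual_galg C) snd := free_comp snd d (quot_repr q).
have qr : q = quot_pi _ r.
  rewrite -[LHS]qd -[q in LHS]quot_reprK; exact: trunc_comp_pi.
rewrite qr -(raddf0 (quot_pi _)); apply/quot_piP; rewrite subr0.
apply/asboolP => y i _; have [->|z0] := eqVneq (coeff y r) 0; first by rewrite raddf0.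
have zd : homog (ga_gr (dual_galg C)) (d - y.2) (coeff y r).
  by rewrite /r coeff_free_comp; exact: homog_comp.
have [n [a [an jn nJ /eqP[]]]] := (JP y).2 _ zd z0.
(* As [a] kills [q], the coefficient of [a *: r] at [y] has no component below [J y]; but it is the
   nonzero [a * z], with [z] the coefficient of [r], in degree [n + (d - y.2)]. *)
have := qj n a jn an; rewrite qr -linearZ -(raddf0 (quot_pi _)) => /quot_piP.
rewrite subr0 => /asboolP/(_ y _ nJ); rewrite coeffZ => <-.
by symmetry; apply: ga_mul an zd.
Qed.
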